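(* Let $R=\bigoplus_{n\in\mathbb{N}_0}R_n$ be a standard graded Noetherian ring whose base ring $R_0$ is local with maximal ideal $\mathfrak{m}_0$, and let $M$ be a finitely generated graded $R$-module. If $c\in\mathbb{Z}$ and $H^{i}_{R_+,\mathfrak{m}_0R}(M)$ is an Artinian $R$-module for all $i>c$, then the $R$-module $H^{c}_{R_+,\mathfrak{m}_0R}(M)/\mathfrak{m}_0H^{c}_{R_+,\mathfrak{m}_0R}(M)$ is Artinian.
   Context: All rings are commutative Noetherian with identity. ''Standard graded'' means that $R=\bigoplus_{n\in\mathbb{N}_0}R_n$ is generated as an $R_0$-algebra by finitely many elements of $R_1$; $R_+:=\bigoplus_{n\geq 1}R_n$. For ideals $I,J$ of $R$ and an $R$-module $M$, the $(I,J)$-torsion submodule is $\Gamma_{I,J}(M):=\{x\in M: I^nx\subseteq Jx \text{ for } n\gg 1\}$ (equivalently, $I^n\subseteq \mathrm{Ann}(x)+J$ for some $n$), and $H^i_{I,J}(-)$ is the $i$-th right derived functor of $\Gamma_{I,J}(-)$ (zero for $i<0$). *)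

(* Defs.v *)
From HB Require Import structures.
From mathcomp Require Import all_boot all_order all_algebra.
From mathcomp Require Import ring_quotient generic_quotient.
From mathcomp Require Import boolp classical_sets ring.

Set Implicit Arguments.
Unset Strict Implicit.
Unset Printing Implicit Defensive.

Import GRing.Theory.

Local Open Scope ring_scope.

(** Submodules are the library's [submodClosed] predicates; they are boolean, *)
(** and Prop-valued conditions are turned into such predicates by [asbool].   *)
(** Ideals of R are the submodules of the regular module [R^o].               *)

Definition ideal (R : comNzRingType) := submodClosed R^o.

Section Submodule.
Variables (R : comNzRingType) (M : lmodType R) (S : submodClosed M).

Record submodule := Submodule { submodule_val :> M; _ : submodule_val \in S }.

HB.instance Definition _ := [isSub for submodule_val].
HB.instance Definition _ := [Choice of submodule by <:].
HB.instance Definition _ := [SubChoice_isSubLmodule of submodule by <:].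
End Submodule.

Section QuotientModule.
Variables (R : comNzRingType) (M : lmodType R) (S : submodClosed M).

Local Open Scope quotient_scope.

Lemma submodB x y : x \in S -> y \in S -> x - y \in S.
Proof. by move=> xS yS; rewrite -scaleN1r rpredD ?rpredZ. Qed.

(** [submodClosed] does not inherit from [zmodClosed], which is what the      *)
(** library's quotients require.                                              *)
Definition submod_zmod : {pred M} := fun x => x \in S.

Fact submod_zmod_closed : zmod_closed submod_zmod.
Proof. by split=> [|x y]; [apply: rpred0 | apply: submodB]. Qed.

HB.instance Definition _ :=
  GRing.isZmodClosed.Build M submod_zmod submod_zmod_closed.

Definition quotient_module := Quotient.quot submod_zmod.

HB.instance Definition _ := GRing.Zmodule.on quotient_module.

Definition qm_pi (x : M) : quotient_module :=
  \pi_(Quotient.quot submod_zmod) x.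

Definition qm_scale (a : R) (x : quotient_module) : quotient_module :=
  qm_pi (a *: repr x).

Lemma qm_piP x y : (qm_pi x == qm_pi y) = (x - y \in S).
Proof. by rewrite -[RHS]/(x - y \in submod_zmod) Quotient.idealrBE. Qed.

Lemma qm_piD x y : qm_pi (x + y) = qm_pi x + qm_pi y.
Proof. exact: raddfD. Qed.

Lemma qm_piW (P : quotient_module -> Prop) :
  (forall x, P (qm_pi x)) -> forall x, P x.
Proof. by move=> Px x; rewrite -[x]reprK; apply: Px. Qed.

Lemma qm_piZ a x : qm_scale a (qm_pi x) = qm_pi (a *: x).
Proof.
apply/eqP; rewrite qm_piP -scalerBr rpredZ // -qm_piP.
by apply/eqP; apply: reprK.
Qed.

Fact qm_scalerA a b v : qm_scale a (qm_scale b v) = qm_scale (a * b) v.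
Proof. by elim/qm_piW: v => x; rewrite !qm_piZ scalerA. Qed.

Fact qm_scale1r : left_id 1 qm_scale.
Proof. by elim/qm_piW => x; rewrite qm_piZ scale1r. Qed.

Fact qm_scalerDr : right_distributive qm_scale +%R.
Proof.
by move=> a; elim/qm_piW=> x; elim/qm_piW=> y;
  rewrite -qm_piD !qm_piZ scalerDr qm_piD.
Qed.

Fact qm_scalerDl v : {morph qm_scale^~ v : a b / a + b}.
Proof.
by move=> a b; elim/qm_piW: v => x; rewrite !qm_piZ scalerDl qm_piD.
Qed.

HB.instance Definition _ := GRing.Zmodule_isLmodule.Build R quotient_module
  qm_scalerA qm_scale1r qm_scalerDr qm_scalerDl.

Fact qm_pi_is_linear : linear qm_pi.
Proof. by move=> a x y; rewrite qm_piD -qm_piZ. Qed.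

HB.instance Definition _ :=
  GRing.isLinear.Build R M quotient_module *:%R qm_pi qm_pi_is_linear.
End QuotientModule.

Section Span.
Variables (R : comNzRingType) (M : lmodType R) (X : set M).

Definition span_mod : {pred M} :=
  fun x => `[< forall S : submodClosed M, (forall y, X y -> y \in S) ->
               x \in S >].

Fact span_mod_submod_closed : submod_closed span_mod.
Proof.
split=> [|a u v /asboolP uX /asboolP vX]; apply/asboolP => S XS.
  exact: rpred0.
by rewrite rpredD ?rpredZ ?uX ?vX.
Qed.

HB.instance Definition _ :=
  GRing.isSubmodClosed.Build R M span_mod span_mod_submod_closed.
End Span.

Section KernelImage.
Variables (R : comNzRingType) (M N : lmodType R) (f : {linear M -> N}).

Definition ker_mod : {pred M} := fun x => f x == 0.

Fact ker_mod_submod_closed : submod_closed ker_mod.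
Proof.
split=> [|a u v /eqP fu /eqP fv]; apply/eqP; first exact: linear0.
by rewrite linearP fu fv scaler0 addr0.
Qed.

HB.instance Definition _ :=
  GRing.isSubmodClosed.Build R M ker_mod ker_mod_submod_closed.

Definition im_mod : {pred N} := fun y => `[< exists x, f x = y >].

Fact im_mod_submod_closed : submod_closed im_mod.
Proof.
split=> [|a _ _ /asboolP[u <-] /asboolP[v <-]]; apply/asboolP.
  by exists 0; apply: linear0.
by exists (a *: u + v); apply: linearP.
Qed.

HB.instance Definition _ :=
  GRing.isSubmodClosed.Build R N im_mod im_mod_submod_closed.
End KernelImage.

Section Preimage.
Variables (R : comNzRingType) (M N : lmodType R) (f : {linear M -> N}).
Variable S : submodClosed N.

Definition preim_mod : {pred M} := fun x => f x \in S.

Fact preim_mod_submod_closed : submod_closed preim_mod.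
Proof.
split=> [|a u v fu fv]; rewrite /in_mem /= /preim_mod ?linear0 ?rpred0 //.
by rewrite linearP rpredD ?rpredZ.
Qed.

HB.instance Definition _ :=
  GRing.isSubmodClosed.Build R M preim_mod preim_mod_submod_closed.
End Preimage.

Definition zero_mod (R : comNzRingType) (M : lmodType R) : {pred M} :=
  fun x => x == 0.

Fact zero_mod_submod_closed (R : comNzRingType) (M : lmodType R) :
  submod_closed (@zero_mod R M).
Proof.
split=> [|a u v /eqP -> /eqP ->]; apply/eqP => //.
by rewrite scaler0 addr0.
Qed.

HB.instance Definition _ (R : comNzRingType) (M : lmodType R) :=
  GRing.isSubmodClosed.Build R M (@zero_mod R M) (@zero_mod_submod_closed R M).

Definition noetherian_module (R : comNzRingType) (M : lmodType R) : Prop :=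
  forall S : nat -> submodClosed M,
    (forall n, {subset S n <= S n.+1}) ->
    exists N, forall n, (N <= n)%N -> S n =i S N.

Definition artinian_module (R : comNzRingType) (M : lmodType R) : Prop :=
  forall S : nat -> submodClosed M,
    (forall n, {subset S n.+1 <= S n}) ->
    exists N, forall n, (N <= n)%N -> S n =i S N.

Definition noetherian_ring (R : comNzRingType) : Prop := noetherian_module R^o.

Definition finitely_generated (R : comNzRingType) (M : lmodType R) : Prop :=
  exists s : seq M, forall x, x \in span_mod [set` s].

Definition maximal_ideal (A : comNzRingType) (m : ideal A) : Prop :=
  1 \notin m /\
  forall J : ideal A, {subset m <= J} -> 1 \notin J -> {subset J <= m}.

Definition local_ring (A : comNzRingType) (m : ideal A) : Prop :=
  maximal_ideal m /\ forall m' : ideal A, maximal_ideal m' -> m' =i m.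

Section IdealPowers.
Variable R : comNzRingType.
Implicit Types I J : ideal R.

Definition ideal_mul I J : ideal R :=
  span_mod [set c : R^o | exists a b, [/\ a \in I, b \in J & c = a * b]].

Fixpoint ideal_exp I (n : nat) : ideal R :=
  if n is n'.+1 then ideal_mul I (ideal_exp I n') else span_mod setT.

Lemma ideal_expD I m n (S : ideal R) :
  (forall p q : R, p \in ideal_exp I m -> q \in ideal_exp I n -> p * q \in S) ->
  {subset ideal_exp I (m + n) <= S}.
Proof.
elim: m S => [|m IHm] S pqS.
  move=> q qI; rewrite -[q]mul1r; apply: pqS => //.
  by apply/asboolP => T; apply.
move=> c /asboolP; apply=> _ [a [b [aI bI ->]]].
suff /(_ b bI) : {subset ideal_exp I (m + n) <= preim_mod ( *:%R a : {linear R^o -> R^o}) S}.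
  by [].
apply: IHm => p q pI qI; suff: a * (p * q) \in S by [].
rewrite mulrA; apply: pqS => //; apply/asboolP => T; apply.
by exists a, p.
Qed.
End IdealPowers.

Section Torsion.
Variables (R : comNzRingType) (I J : ideal R).

Section TorsionSubmodule.
Variable M : lmodType R.

(** Membership of x: for all n >> 0, I^n x is contained in J x.               *)
Definition torsion_mod : {pred M} :=
  fun x => `[< exists n0, forall n, (n0 <= n)%N ->
                 forall a, a \in ideal_exp I n ->
                   exists2 b, b \in J & a *: x = b *: x >].

Definition ann_plus (x : M) : {pred R^o} :=
  fun a => `[< exists2 b, b \in J & (a : R) *: x = (b : R) *: x >].

Fact ann_plus_submod_closed x : submod_closed (ann_plus x).
Proof.
split=> [|a u v /asboolP[b bJ ub] /asboolP[c cJ vc]]; apply/asboolP.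
  by exists 0; rewrite ?rpred0.
exists (a *: b + c); first by rewrite rpredD ?rpredZ.
by rewrite !scalerDl vc; congr (_ + _); rewrite -!scalerA ub.
Qed.

HB.instance Definition _ x :=
  GRing.isSubmodClosed.Build R R^o (ann_plus x) (ann_plus_submod_closed x).

Fact torsion_mod_submod_closed : submod_closed torsion_mod.
Proof.
split=> [|c u v /asboolP[m mu] /asboolP[n nv]]; apply/asboolP.
  by exists 0 => n _ a _; exists 0; rewrite ?rpred0 ?scaler0.
exists (m + n)%N => k mnk a aI.
have /subnKC Dk : (m <= k)%N := leq_trans (leq_addr n m) mnk.
have nk : (n <= k - m)%N by rewrite leq_subRL // (leq_trans (leq_addr n m)).
suff /(_ a) : {subset ideal_exp I (m + (k - m)) <= ann_plus (c *: u + v)}.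
  by rewrite Dk => /(_ aI) /asboolP.
apply: ideal_expD => p q pI qI.
have [b bJ pb] := mu _ (leqnn _) _ pI; have [d dJ qd] := nv _ nk _ qI.
apply/asboolP; exists (p *: d + q *: b - b *: d).
  by rewrite submodB ?rpredD ?rpredZ.
have pu : (p - b) *: u = 0 by rewrite scalerBl pb subrr.
have qv : (q - d) *: v = 0 by rewrite scalerBl qd subrr.
have kill : ((p - b) * (q - d)) *: (c *: u + v) = 0.
  rewrite scalerDr -!scalerA qv scaler0 addr0.
  by rewrite !scalerA mulrC mulrCA mulrC -!scalerA [_ *: u]pu !scaler0.
apply/eqP; rewrite -subr_eq0 -scalerBl -kill; apply/eqP; congr (_ *: _).
have mulE (x y z t : R) : x * y - (x * t + y * z - z * t) = (x - z) * (y - t).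
  by ring.
exact: mulE.
Qed.

HB.instance Definition _ :=
  GRing.isSubmodClosed.Build R M torsion_mod torsion_mod_submod_closed.

Definition Gamma : lmodType R := submodule torsion_mod.
End TorsionSubmodule.

Section TorsionMap.
Variables (M N : lmodType R) (f : {linear M -> N}).

Fact Gamma_map_subproof (x : Gamma M) : f (val x) \in @torsion_mod N.
Proof.
have /asboolP[n0 xn0] := valP x; apply/asboolP; exists n0 => n n0n a aI.
have [b bJ ab] := xn0 n n0n a aI.
by exists b => //; rewrite -!linearZ /= ab.
Qed.

Definition Gamma_map (x : Gamma M) : Gamma N :=
  Submodule (Gamma_map_subproof x).

Fact Gamma_map_is_linear : linear Gamma_map.
Proof. by move=> a x y; apply: val_inj; rewrite /= linearP. Qed.

HB.instance Definition _ :=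
  GRing.isLinear.Build R (Gamma M) (Gamma N) *:%R Gamma_map Gamma_map_is_linear.
End TorsionMap.
End Torsion.

Arguments Gamma_map {R} I J {M N} f x.

Section Cohomology.
Variables (R : comNzRingType) (C : nat -> lmodType R).
Variable d : forall n, {linear C n -> C n.+1}.

Definition boundaries (n : nat) : submodClosed (C n) :=
  if n is n'.+1 then im_mod (d n') : submodClosed (C n'.+1)
  else @zero_mod R (C 0).

Definition cohomology (n : nat) : lmodType R :=
  quotient_module
    (preim_mod (val : {linear submodule (ker_mod (d n)) -> C n})
       (boundaries n)).
End Cohomology.

Definition injective_module (R : comNzRingType) (E : lmodType R) : Prop :=
  forall (A B : lmodType R) (f : {linear A -> B}) (g : {linear A -> E}),
    injective f -> exists h : {linear B -> E}, forall x, h (f x) = g x.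

Record injective_resolution (R : comNzRingType) (M : lmodType R) := {
  ir_obj :> nat -> lmodType R;
  ir_diff : forall n, {linear ir_obj n -> ir_obj n.+1};
  ir_aug : {linear M -> ir_obj 0};
  ir_injective : forall n, injective_module (ir_obj n);
  ir_aug_inj : injective ir_aug;
  ir_exact0 : forall x, ir_diff 0 x = 0 <-> exists y, ir_aug y = x;
  ir_exactS : forall n x,
    ir_diff n.+1 x = 0 <-> exists y, ir_diff n y = x
}.

(** The right derived functors of Gamma I J at M, computed from an injective  *)
(** resolution E of M.                                                        *)
Definition local_cohomology (R : comNzRingType) (I J : ideal R)
    (M : lmodType R) (E : injective_resolution M) (i : int) : lmodType R :=
  match i with
  | Posz n => cohomology (fun k => Gamma_map I J (ir_diff E k)) n
  | Negz _ => 'rV[R]_0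
  end.

Definition direct_sum (I : choiceType) (V : zmodType)
    (A : I -> zmodClosed V) : Prop :=
  (forall x, exists (s : seq I) (f : I -> V),
     [/\ uniq s, forall i, f i \in A i & x = \sum_(i <- s) f i]) /\
  (forall (s : seq I) (f : I -> V), uniq s -> (forall i, f i \in A i) ->
     \sum_(i <- s) f i = 0 -> forall i, i \in s -> f i = 0).

Record ring_grading (R : comNzRingType) := {
  gr_comp :> nat -> zmodClosed R;
  gr_one : 1 \in gr_comp 0;
  gr_mul : forall m n x y,
    x \in gr_comp m -> y \in gr_comp n -> x * y \in gr_comp (m + n);
  gr_sum : direct_sum gr_comp
}.

Record module_grading (R : comNzRingType) (G : ring_grading R)
    (M : lmodType R) := {
  mgr_comp :> int -> zmodClosed M;
  mgr_scale : forall (m : nat) (n : int) a x,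
    a \in G m -> x \in mgr_comp n -> a *: x \in mgr_comp (m%:Z + n);
  mgr_sum : direct_sum mgr_comp
}.

Section GradedRing.
Variables (R : comNzRingType) (G : ring_grading R).

Definition degree0 : {pred R} := fun x => x \in G 0.

Fact degree0_subring_closed : subring_closed degree0.
Proof.
split=> [|x y|x y]; rewrite /in_mem /= /degree0; first exact: gr_one.
  exact: rpredB.
exact: (@gr_mul _ G 0 0).
Qed.

HB.instance Definition _ :=
  GRing.isSubringClosed.Build R degree0 degree0_subring_closed.

Record base_ring := BaseRing { base_val :> R; _ : base_val \in degree0 }.

HB.instance Definition _ := [isSub for base_val].
HB.instance Definition _ := [Choice of base_ring by <:].
HB.instance Definition _ := [SubChoice_isSubComNzRing of base_ring by <:].

Definition standard_graded : Prop :=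
  exists2 s : seq R, {subset s <= G 1} &
    forall S : subringClosed R,
      {subset G 0 <= S} -> {subset s <= S} -> forall x, x \in S.

Definition irrelevant : {pred R^o} :=
  fun x => `[< exists n (f : nat -> R), (forall i, f i \in G i.+1) /\
                 x = \sum_(i < n) f i >].

Lemma irrelevant_comp k x : x \in G k.+1 -> x \in irrelevant.
Proof.
move=> xG; apply/asboolP.
exists k.+1, (fun i => if i == k then x else 0); split=> [i|].
  by case: eqP => [->|_] //; apply: rpred0.
rewrite big_ord_recr /= eqxx big1 ?add0r // => i _.
by rewrite ltn_eqF.
Qed.

Fact irrelevantD : {in irrelevant &, forall x y, x + y \in irrelevant}.
Proof.
have pad n (f : nat -> R) m : (n <= m)%N ->
    \sum_(i < n) f i = \sum_(i < m) (if (i < n)%N then f i else 0).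
  by move=> nm; rewrite (big_ord_widen m) // big_mkcond.
move=> _ _ /asboolP[n [f [fG ->]]] /asboolP[m [g [gG ->]]]; apply/asboolP.
exists (n + m)%N.
exists (fun i => (if (i < n)%N then f i else 0) + (if (i < m)%N then g i else 0)).
split=> [i|]; first by rewrite rpredD //; case: ifP => // _; apply: rpred0.
by rewrite big_split -!pad ?leq_addr ?leq_addl.
Qed.

Fact irrelevant_submod_closed : submod_closed irrelevant.
Proof.
have I0 : 0 \in irrelevant by apply: (@irrelevant_comp 0); apply: rpred0.
split=> // a u v uI vI; apply: irrelevantD => //.
have [/(_ a)[s [g [_ gG ->]]] _] := gr_sum G.
case/asboolP: uI => n [f [fG ->]].
rewrite /GRing.scale /= big_distrl /=.
apply: (big_ind (fun x => x \in irrelevant)) => // [x y|j _].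
  exact: irrelevantD.
rewrite big_distrr /=.
apply: (big_ind (fun x => x \in irrelevant)) => // [x y|i _].
  exact: irrelevantD.
by apply: (@irrelevant_comp (j + i)); rewrite -addnS gr_mul.
Qed.

HB.instance Definition _ :=
  GRing.isSubmodClosed.Build R R^o irrelevant irrelevant_submod_closed.

(** m H for an ideal m of the base ring and an R-module H; for H = R^o this   *)
(** is the extended ideal m R.                                                *)
Definition base_smul (m : ideal base_ring) (H : lmodType R) : submodClosed H :=
  span_mod [set x : H | exists a h, a \in m /\ x = base_val a *: h].
End GradedRing.

(* Main.v *)
Require Import Defs.
From HB Require Import structures.
From mathcomp Require Import all_boot all_order all_algebra.
From mathcomp Require Import boolp classical_sets ring.
Set Implicit Arguments.
Unset Strict Implicit.
Unset Printing Implicit Defensive.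
Import Order.TTheory GRing.Theory Num.Theory.
Local Open Scope ring_scope.
Local Open Scope classical_set_scope.

(** Put I = R_+ and J = m0 R; only the maximality of I + J matters.  Choose
    generators x_i of J and y_j of I, and let E be the injective resolution.
    Instead of passing to quotients M / xM one takes successive mapping cones
    (Koszul complexes) of the complex Gamma E itself, Gamma = Gamma_{I,J}, so
    that no other resolution is needed.  A cone of multiplication by z on F
    gives exact sequences
      0 -> H^n(F) / z H^n(F) -> H^n(cone) -> (0 : z) in H^{n+1}(F) -> 0.

    (1) After the cones over all the x_i and y_j, the inclusion of Gamma E in E
    becomes a quasi-isomorphism.  Indeed Gamma is the composite of the functors
    Gamma_{y_j,J}, and multiplication by y_j is bijective on
    Gamma_{y_1..y_(j-1),J} E / Gamma_{y_1..y_j,J} E: up to y-torsion, an element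
    x of an injective module over a Noetherian ring is divisible by y, by an
    element whose annihilator contains ann x.  The cohomology of the cone of E
    is Noetherian and torsion for the maximal ideal I + J, hence Artinian.
    (2) The cohomology of the cone of Gamma E over the x_i alone is y_j-torsion
    for all j, so Melkersson's criterion removes the cones over the y_j.
    (3) The cones over the x_i are removed one at a time with the sequence
    above: if H^{n+1}(F) is Artinian and H^n(cone) / (x_2, .., x_r) is Artinian,
    then so is H^n(F) / (x_1, .., x_r). *)

(** * Chain conditions on intervals of submodules *)

Section ChainConditions.
Context (R : comNzRingType).

(** Prop-valued sets rather than [submodClosed] predicates: sums and images need no packing, and
    chains stabilise by equality of sets. *)
Definition submod (M : lmodType R) (S : set M) : Prop :=
  S 0 /\ forall a x y, S x -> S y -> S (a *: x + y).

Section Submod.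
Context (M : lmodType R) (S : set M) (hS : submod S).

Lemma submodD x y : S x -> S y -> S (x + y).
Proof. by move=> Sx Sy; rewrite -[x]scale1r; apply: hS.2. Qed.

Lemma submodZ a x : S x -> S (a *: x).
Proof. by move=> Sx; rewrite -[_ *: _]addr0; apply: hS.2 => //; case: hS. Qed.

Lemma submodN x : S x -> S (- x).
Proof. by rewrite -scaleN1r; apply: submodZ. Qed.

Lemma submod_sub x y : S x -> S y -> S (x - y).
Proof. by move=> Sx Sy; apply: submodD => //; apply: submodN. Qed.

Lemma submod_cancel x y : S y -> S (x + y) -> S x.
Proof. by move=> Sy /submod_sub/(_ Sy); rewrite addrK. Qed.
End Submod.

Definition addS (M : lmodType R) (S T : set M) : set M :=
  [set x | exists a b, [/\ S a, T b & x = a + b]].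

Section LinearMap.
Context (M N : lmodType R) (f : M -> N) (flin : linear f).

Lemma lin0 : f 0 = 0.
Proof. by have := flin (-1) 0 0; rewrite !scaleN1r !addNr. Qed.

Lemma linD x y : f (x + y) = f x + f y.
Proof. by rewrite -[x in LHS]scale1r flin scale1r. Qed.

Lemma linZ a x : f (a *: x) = a *: f x.
Proof. by rewrite -[a *: x]addr0 flin lin0 addr0. Qed.

Lemma linN x : f (- x) = - f x.
Proof. by rewrite -scaleN1r linZ scaleN1r. Qed.

Lemma linB x y : f (x - y) = f x - f y.
Proof. by rewrite linD linN. Qed.

Lemma submod_image S : submod S -> submod (f @` S).
Proof.
move=> [S0 hS]; split=> [|a _ _ [x Sx <-] [y Sy <-]]; first by exists 0; rewrite ?lin0.
by exists (a *: x + y); [apply: hS | rewrite flin].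
Qed.

Lemma submod_preimage S : submod S -> submod (f @^-1` S).
Proof.
move=> [S0 hS]; split=> [|a x y Sx Sy]; rewrite /preimage /= ?lin0 // flin.
exact: hS.
Qed.
End LinearMap.

Section Lattice.
Context (M : lmodType R).
Implicit Types S T : set M.

Lemma submod_add S T : submod S -> submod T -> submod (addS S T).
Proof.
move=> hS hT; split=> [|a _ _ [u [v [Su Tv ->]]] [w [t [Sw Tt ->]]]].
  by exists 0, 0; split; [case: hS | case: hT | rewrite addr0].
exists (a *: u + w), (a *: v + t).
by split; [apply: hS.2 | apply: hT.2 | rewrite scalerDr addrACA].
Qed.

Lemma submodI S T : submod S -> submod T -> submod (S `&` T).
Proof.
move=> hS hT; split=> [|a x y [Sx Tx] [Sy Ty]].
  by split; [case: hS | case: hT].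
by split; [apply: hS.2 | apply: hT.2].
Qed.

Lemma submod_zero : submod [set (0 : M)].
Proof. by split=> // a _ _ -> ->; rewrite /set1 /= scaler0 addr0. Qed.

Lemma addSl S T : T 0 -> S `<=` addS S T.
Proof. by move=> T0 x Sx; exists x, 0; rewrite addr0. Qed.

Lemma addSr S T : S 0 -> T `<=` addS S T.
Proof. by move=> S0 x Tx; exists 0, x; rewrite add0r. Qed.

Lemma addS_sub S T U : submod U -> S `<=` U -> T `<=` U -> addS S T `<=` U.
Proof.
by move=> hU SU TU _ [a [b [/SU Ua /TU Ub ->]]]; apply: submodD.
Qed.

Lemma addSS S T S' T' : S `<=` S' -> T `<=` T' -> addS S T `<=` addS S' T'.
Proof. by move=> SS TT _ [a [b [/SS Sa /TT Tb ->]]]; exists a, b. Qed.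
End Lattice.

Definition between (M : lmodType R) (A B S : set M) : Prop :=
  [/\ submod S, A `<=` S & S `<=` B].

(** For submodules A and B of M: B / A is Noetherian ([up]) or Artinian.      *)
Definition chain_cond (up : bool) (M : lmodType R) (A B : set M) : Prop :=
  forall S : nat -> set M, (forall n, between A B (S n)) ->
    (forall n, if up then S n `<=` S n.+1 else S n.+1 `<=` S n) ->
    exists N, forall n, (N <= n)%N -> S n = S N.

Lemma chain_mono up (M : lmodType R) (S : nat -> set M) :
  (forall n, if up then S n `<=` S n.+1 else S n.+1 `<=` S n) ->
  forall m n, (m <= n)%N -> if up then S m `<=` S n else S n `<=` S m.
Proof.
move=> hS m n /subnK <-; elim: (n - m)%N => [|k IH]; first by case: (up).
rewrite addSn; move: IH (hS (k + m)%N); case: (up) => IH hk x Sx.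
  by apply/hk/IH.
by apply/IH/hk.
Qed.

Lemma chain_anti (M : lmodType R) (S : nat -> set M) :
  (forall n, S n.+1 `<=` S n) -> forall m n, (m <= n)%N -> S n `<=` S m.
Proof. exact: (@chain_mono false). Qed.

(** The common core of [chain_cond_inj], [chain_cond_surj] and [chain_cond_ext]: a chain stops once
    its images under two monotone maps stop, if the two maps together separate comparable
    submodules. *)
Lemma chain_cond_transfer up (M M1 M2 : lmodType R) (A B : set M)
    (A1 B1 : set M1) (A2 B2 : set M2) (f1 : set M -> set M1)
    (f2 : set M -> set M2) :
  chain_cond up A1 B1 -> chain_cond up A2 B2 ->
  (forall S, between A B S -> between A1 B1 (f1 S)) ->
  (forall S, between A B S -> between A2 B2 (f2 S)) ->
  {homo f1 : S T / S `<=` T} -> {homo f2 : S T / S `<=` T} ->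
  (forall S T, between A B S -> between A B T -> S `<=` T ->
     f1 T = f1 S -> f2 T = f2 S -> T `<=` S) ->
  chain_cond up A B.
Proof.
move=> cc1 cc2 b1 b2 m1 m2 refl S hS cS.
have [||N1 h1] := cc1 (f1 \o S) => [n|n|].
- exact: b1.
- by move: (cS n); case: (up); apply: m1.
have [||N2 h2] := cc2 (f2 \o S) => [n|n|].
- exact: b2.
- by move: (cS n); case: (up); apply: m2.
exists (maxn N1 N2) => n len.
have e1 : f1 (S n) = f1 (S (maxn N1 N2)).
  rewrite -[LHS]/((f1 \o S) n) h1 ?(leq_trans (leq_maxl _ _) len) //.
  by rewrite -[RHS]/((f1 \o S) _) h1 ?leq_maxl.
have e2 : f2 (S n) = f2 (S (maxn N1 N2)).
  rewrite -[LHS]/((f2 \o S) n) h2 ?(leq_trans (leq_maxr _ _) len) //.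
  by rewrite -[RHS]/((f2 \o S) _) h2 ?leq_maxr.
apply/seteqP; move: (chain_mono cS len).
by case: (up) => le; split=> //; apply: refl => //; rewrite ?e1 ?e2.
Qed.

(** Submodules S of the interval are told apart by f(S) + A', as an element of B that f sends into
    A' already lies in A. *)
Lemma chain_cond_inj up (M N : lmodType R) (A B : set M) (A' B' : set N)
    (f : M -> N) :
  linear f -> submod A' -> submod B' -> submod B ->
  chain_cond up A' B' -> A' `<=` B' ->
  (forall x, B x -> B' (f x)) -> (forall x, B x -> A' (f x) -> A x) ->
  chain_cond up A B.
Proof.
move=> flin hA' hB' hB cc sAB fB fA.
have mono : {homo (fun S => addS (f @` S) A') : S T / S `<=` T}.
  move=> S T ST; apply: addSS => // _ [x Sx <-].
  by exists x => //; apply: ST.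
have btw S : between A B S -> between A' B' (addS (f @` S) A').
  move=> [hS AS SB]; split.
  - by apply: submod_add => //; apply: submod_image.
  - by apply: addSr; exists 0; [case: hS | apply: lin0].
  - by apply: addS_sub => // _ [x Sx <-]; apply/fB/SB.
apply: (chain_cond_transfer cc cc btw btw) => // S T [hS AS SB] [hT AT TB] ST.
move=> e _ x Tx; have : addS (f @` T) A' (f x).
  by apply: addSl; [case: hA' | exists x].
rewrite e => -[_ [b [[s Ss <-] A'b fx]]].
have : S (x - s).
  apply/AS/fA; first by apply: submod_sub => //; [apply: TB | apply: SB].
  by rewrite linB // fx addrC addKr.
by move=> /(submodD hS)/(_ Ss); rewrite subrK.
Qed.

(** Submodules of the target interval are told apart by their preimages in B, since f(B) + A' covers
    B'. *)
Lemma chain_cond_surj up (M N : lmodType R) (A B : set M) (A' B' : set N)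
    (f : M -> N) :
  linear f -> submod B ->
  chain_cond up A B -> A `<=` B ->
  (forall x, A x -> A' (f x)) ->
  (forall y, B' y -> exists2 x, B x & A' (y - f x)) ->
  chain_cond up A' B'.
Proof.
move=> flin hB cc sAB fA fB.
have mono : {homo (fun S => B `&` (f @^-1` S)) : S T / S `<=` T}.
  by move=> S T ST x [Bx Sx]; split=> //; apply: ST.
have btw S : between A' B' S -> between A B (B `&` (f @^-1` S)).
  move=> [hS AS SB]; split.
  - by apply: submodI => //; apply: submod_preimage.
  - by move=> x Ax; split; [apply: sAB | apply/AS/fA].
  - by move=> x [].
apply: (chain_cond_transfer cc cc btw btw) => // S T [hS AS SB] [hT AT TB] ST.
move=> e _ y Ty; have [x Bx A'x] := fB y (TB y Ty).
have : (B `&` (f @^-1` T)) x.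
  split=> //; have := submod_sub hT Ty (AT _ A'x).
  by rewrite opprB addrC subrK.
rewrite e => -[_ Sfx].
by have := submodD hS (AS _ A'x) Sfx; rewrite subrK.
Qed.

Section Intervals.
Context (M : lmodType R).
Implicit Types A B C : set M.

Lemma id_linear : linear (@id M). Proof. by []. Qed.

(** By the modular law, comparable submodules with the same intersection and the same sum with C
    coincide. *)
Lemma chain_cond_ext up A B C :
  submod B -> submod C -> A `<=` C -> C `<=` B ->
  chain_cond up A C -> chain_cond up C B -> chain_cond up A B.
Proof.
move=> hB hC AC CB ccAC ccCB.
apply: (chain_cond_transfer (f1 := fun S => S `&` C)
  (f2 := fun S => addS S C) ccAC ccCB).
- move=> S [hS AS SB]; split; first exact: submodI.
    by move=> x Ax; split; [apply: AS | apply: AC].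
  by move=> x [].
- move=> S [hS AS SB]; split; first exact: submod_add.
    by apply: addSr; case: hS.
  exact: addS_sub.
- by move=> S T ST x [/ST].
- by move=> S T ST; apply: addSS.
move=> S T [hS AS SB] [hT AT TB] ST e1 e2 x Tx.
have : addS T C x by apply: addSl => //; case: hC.
rewrite e2 => -[s [c [Ss Cc xE]]].
have : (T `&` C) c.
  by split=> //; apply: (submod_cancel hT (ST _ Ss)); rewrite addrC -xE.
by rewrite e1 xE => -[Sc _]; apply: submodD.
Qed.

Lemma chain_cond_triv up A B : B `<=` A -> chain_cond up A B.
Proof.
move=> BA S hS _; exists 0%N => n _; apply/seteqP.
have [_ An nB] := hS n; have [_ A0 oB] := hS 0%N.
by split=> x; [move/nB/BA/A0 | move/oB/BA/An].
Qed.

Lemma chain_cond_sub up A B A' B' :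
  submod A -> submod B -> submod B' -> A `<=` B -> B' `<=` B ->
  (forall x, B' x -> A x -> A' x) ->
  chain_cond up A B -> chain_cond up A' B'.
Proof.
move=> hA hB hB' AB B'B AA' cc.
exact: (chain_cond_inj id_linear hA hB hB' cc AB).
Qed.
End Intervals.
End ChainConditions.

(** * Finitely generated modules and criteria for the Artinian property *)

Section FiniteGeneration.
Context (R : comNzRingType) (M : lmodType R).
Implicit Types U V : set M.

Fixpoint extend (U : set M) (s : seq M) : set M :=
  if s is a :: s' then [set x | exists r y, extend U s' y /\ x = r *: a + y]
  else U.

Lemma submod_extend U s : submod U -> submod (extend U s).
Proof.
move=> hU; elim: s => //= a s [h0 hs]; split=> [|c _ _ [r [x [hx ->]]] [t [y [hy ->]]]].
  by exists 0, 0; rewrite scale0r add0r.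
exists (c * r + t), (c *: x + y); split; first exact: hs.
by rewrite scalerDr addrACA scalerA scalerDl.
Qed.

Lemma extend_cons U a s : extend U s `<=` extend U (a :: s).
Proof. by move=> x Ux; exists 0, x; rewrite scale0r add0r. Qed.

Lemma extend_base U s : U `<=` extend U s.
Proof. by elim: s => //= a s IH x /IH /(@extend_cons U a). Qed.

Lemma extend_head U a s : submod U -> extend U (a :: s) a.
Proof.
by move=> /(submod_extend s)[U0 _]; exists 1, 0; rewrite scale1r addr0.
Qed.

Lemma extend_sub U V s :
  submod V -> U `<=` V -> (forall a, a \in s -> V a) -> extend U s `<=` V.
Proof.
move=> hV UV; elim: s => //= a s IH sV x [r [y [hy ->]]].
apply: hV.2; first by apply: sV; rewrite mem_head.
by apply: IH => // b bs; apply: sV; rewrite inE bs orbT.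
Qed.

Lemma mem_extend U s a : submod U -> a \in s -> extend U s a.
Proof.
move=> hU; elim: s => //= b s IH; rewrite inE => /predU1P[->|/IH].
  exact: extend_head.
exact: extend_cons.
Qed.

(** Each further generator a contributes a cyclic quotient, onto which R / I maps by r |-> r a. *)
Lemma chain_cond_extend up (I : set R^o) U s :
  submod I -> submod U -> (forall a r, a \in s -> I r -> U (r *: a)) ->
  chain_cond up I setT -> chain_cond up U (extend U s).
Proof.
move=> hI hU; elim: s => /= [|a s IH] sU cc; first exact: chain_cond_triv.
apply: (chain_cond_ext (C := extend U s)).
- exact: (submod_extend (a :: s)).
- exact: submod_extend.
- exact: extend_base.
- exact: extend_cons.
- by apply: IH => // b r bs; apply: sU; rewrite inE bs orbT.
apply: (@chain_cond_surj R up R^o M I setT _ _ ( *:%R^~ a)) => //.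
- by move=> c r t; rewrite scalerDl scalerA.
- by move=> r Ir; apply: extend_base; apply: sU; rewrite ?mem_head.
by move=> x [r [y [hy ->]]]; exists r => //; rewrite [_ + y]addrC addrK.
Qed.

Lemma acc_fg U V : submod U -> submod V -> U `<=` V -> chain_cond true U V ->
  exists2 s : seq M, (forall a, a \in s -> V a) & V `<=` extend U s.
Proof.
move=> hU hV UV acc; apply: contrapT => nfg.
have next (s : seq M) : (forall a, a \in s -> V a) -> exists2 v, V v & ~ extend U s v.
  move=> sV; apply: contrapT => nv; apply: nfg; exists s => // v Vv.
  by apply: contrapT => nUv; apply: nv; exists v.
have [f fP] : {f : seq M -> M &
    forall s, (forall a, a \in s -> V a) -> V (f s) /\ ~ extend U s (f s)}.
  apply: (@choice _ _ (fun s v => (forall a, a \in s -> V a) -> V v /\ ~ extend U s v)) => s.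
  have [/next[v Vv nv]|ns] := pselect (forall a, a \in s -> V a).
    by exists v.
  by exists 0.
pose l := fix l n := if n is n'.+1 then f (l n') :: l n' else [::].
have lV n : forall a, a \in l n -> V a.
  elim: n => //= n IH a; rewrite inE => /predU1P[->|/IH //].
  by case: (fP _ IH).
have [||N hN] := acc (fun n => extend U (l n)).
- move=> n; split; [exact: submod_extend | exact: extend_base |].
  exact: extend_sub (lV n).
- by move=> n; apply: extend_cons.
have [_] := fP _ (lV N); apply.
rewrite -(hN N.+1) //; exact: extend_head.
Qed.

(** V / U is a finitely generated module over the Artinian ring R / I. *)
Lemma acc_dcc U V (I : set R^o) : submod U -> submod V -> U `<=` V ->
  submod I -> chain_cond false I setT -> (forall r v, I r -> V v -> U (r *: v)) ->
  chain_cond true U V -> chain_cond false U V.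
Proof.
move=> hU hV UV hI dccI IV /(acc_fg hU hV UV)[s sV Vs].
have -> : V = extend U s.
  by apply/seteqP; split=> //; apply: extend_sub.
by apply: (chain_cond_extend hI) => // a r /sV Va Ir; apply: IV.
Qed.

(** Melkersson's criterion.  A submodule S between A and B is determined by   *)
(** the decreasing sequence y^n (S : y^(n+1)) of submodules of (A : y).       *)
Lemma dcc_torsion (A B : set M) (y : R) :
  submod A -> submod B -> A `<=` B ->
  (forall v, B v -> exists e, A (y ^+ e *: v)) ->
  chain_cond false A [set v | B v /\ A (y *: v)] -> chain_cond false A B.
Proof.
move=> hA hB AB tor dcc S hS cS.
(* Modulo A, [T j n] consists of the y^n b with b in S_j killed by y^(n+1); it decreases in both
   indices. *)
pose T j n : set M :=
  addS [set x | exists b, [/\ S j b, A (y ^+ n.+1 *: b) & x = y ^+ n *: b]] A.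
have Tj j k n : (j <= k)%N -> T k n `<=` T j n.
  move=> /(chain_anti cS) jk; apply: addSS => // _ [b [Sb Ab ->]].
  by exists b; split=> //; apply: jk.
have Tn j n : T j n.+1 `<=` T j n.
  have [hj _ _] := hS j; apply: addSS => // _ [b [Sb Ab ->]].
  exists (y *: b); split; first exact: submodZ.
    by rewrite scalerA -exprSr.
  by rewrite scalerA -exprSr.
have Tjn j n m : (j <= m)%N -> (n <= m)%N -> T m m `<=` T j n.
  move=> jm nm x Tx; apply: (Tj j m) => //.
  exact: (@chain_anti R M (T m) (Tn m) n m nm).
have btw j n : between A [set v | B v /\ A (y *: v)] (T j n).
  have [hj Aj jB] := hS j; split.
  - apply: submod_add => //; split=> [|a _ _ [u [Su Au ->]] [v [Sv Av ->]]].
      by exists 0; rewrite !scaler0; split=> //; [case: hj | case: hA].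
    exists (a *: u + v); split; first exact: hj.2.
      by rewrite scalerDr scalerA mulrC -scalerA; apply: hA.2.
    by rewrite scalerDr !scalerA mulrC.
  - by apply: addSr; exists 0; rewrite !scaler0; split=> //; [case: hj | case: hA].
  - move=> _ [_ [a [[b [Sb Ab ->]] Aa ->]]]; split.
      by apply: submodD => //; [apply: submodZ => //; apply: jB | apply: AB].
    rewrite scalerDr scalerA -exprS; apply: submodD => //; exact: submodZ.
(* The diagonal settles [T j n] for all j, n >= N; the finitely many columns n < N are settled
   separately below. *)
have [||N hN] := dcc (fun m => T m m) => // [n|].
  by move=> x /(Tn _ _)/(@Tj n n.+1 n (leqnSn n)).
have TN j n : (N <= j)%N -> (N <= n)%N -> T j n = T N N.
  move=> Nj Nn; apply/seteqP; split.
    by move=> x /(Tj N j n Nj); apply: (@chain_anti R M (T N) (Tn N) N n Nn).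
  rewrite -(hN (maxn j n)) ?(leq_trans Nj) ?leq_maxl //.
  exact: Tjn (leq_maxl _ _) (leq_maxr _ _).
have [K hK] : exists K, forall n j, (n < N)%N -> (K <= j)%N -> T j n = T K n.
  elim: (N) => [|L [K IH]]; first by exists 0%N.
  have [||K' hK'] := dcc (T ^~ L) => // [n|]; first exact: Tj.
  exists (maxn K K') => n j; rewrite ltnS leq_eqVlt => /predU1P[->|nL].
    rewrite geq_max => /andP[_ Kj].
    by rewrite [LHS]hK' // [RHS]hK' // leq_maxr.
  rewrite geq_max => /andP[Kj _].
  by rewrite [LHS]IH // [RHS]IH // leq_maxl.
pose L := maxn N K; exists L => j Lj; apply/seteqP; split.
  exact: (chain_anti cS Lj).
have TL n : T j n = T L n.
  have [nN|Nn] := ltnP n N.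
    rewrite [LHS]hK // ?[RHS]hK ?leq_maxr //; exact: leq_trans (leq_maxr _ _) Lj.
  by rewrite !TN ?leq_maxl // (leq_trans _ Lj) // leq_maxl.
have [hj Aj jB] := hS j; have [hL AL LB] := hS L.
(* If y^(e+1) kills x modulo A, then y^e x agrees modulo A with y^e b for some b in S_j, and y^e
   kills x - b modulo A. *)
move=> x Lx; have [e] := tor x (LB _ Lx); elim: e x Lx => [|e IH] x Lx Ax.
  by apply: Aj; rewrite -[x]scale1r.
have : T L e (y ^+ e *: x) by apply: addSl; [case: hA | exists x].
rewrite -TL => -[_ [a [[b [Sb Ab ->]] Aa xE]]].
rewrite -[x](subrK b); apply: submodD => //; apply: IH.
  by apply: submod_sub => //; apply: (chain_anti cS Lj).
by rewrite scalerBr xE addrC addKr.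
Qed.

(** One generator is used at a time; each use replaces B by the part of B that y carries into A. *)
Lemma dcc_torsion_seq (A B : set M) (ys : seq R) :
  submod A -> submod B -> A `<=` B ->
  (forall y v, y \in ys -> B v -> exists e, A (y ^+ e *: v)) ->
  chain_cond false A [set v | B v /\ forall y, y \in ys -> A (y *: v)] ->
  chain_cond false A B.
Proof.
move=> hA; elim: ys B => [|y ys IH] B hB AB tor dcc.
  by congr (chain_cond _ _ _): dcc; apply/seteqP; split=> // v [].
apply: (dcc_torsion (y := y)) => //.
  by move=> v; apply: tor; rewrite mem_head.
apply: IH.
- split=> [|a u v [Bu Au] [Bv Av]].
    by rewrite /= scaler0; split; [case: hB | case: hA].
  split; first exact: hB.2.
  by rewrite scalerDr scalerA mulrC -scalerA; apply: hA.2.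
- by move=> v Av; split; [apply: AB | apply: submodZ].
- by move=> z v zs [Bv _]; apply: tor => //; rewrite inE zs orbT.
congr (chain_cond _ _ _): dcc; apply/seteqP; split=> v.
  move=> [Bv h]; split=> [|z zs]; first by split=> //; apply: h; rewrite mem_head.
  by apply: h; rewrite inE zs orbT.
move=> [[Bv Av] h]; split=> // z; rewrite inE => /predU1P[->//|]; exact: h.
Qed.

(** (zs)X + U                                                                 *)
Fixpoint addmul (zs : seq R) (X U : set M) : set M :=
  if zs is z :: zs' then addS ( *:%R z @` X) (addmul zs' X U) else U.

Lemma scale_linear (z : R) : linear ( *:%R z : M -> M).
Proof. by move=> a x y; rewrite scalerDr !scalerA mulrC. Qed.

Lemma submod_addmul zs X U : submod X -> submod U -> submod (addmul zs X U).
Proof.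
move=> hX hU; elim: zs => //= z zs IH; apply: submod_add => //.
apply: submod_image => //; exact: scale_linear.
Qed.

Lemma addmul_base zs X U : submod X -> U `<=` addmul zs X U.
Proof.
move=> [X0 _]; elim: zs => //= z zs IH; apply: (subset_trans IH).
by apply: addSr; exists 0; rewrite ?scaler0.
Qed.

Lemma addmulS zs X Y U V :
  X `<=` Y -> U `<=` V -> addmul zs X U `<=` addmul zs Y V.
Proof.
move=> XY UV; elim: zs => //= z zs IH; apply: addSS => // _ [x Xx <-].
by exists x => //; apply: XY.
Qed.

Lemma addmul_sub zs X U V : submod V -> U `<=` V ->
  (forall z x, z \in zs -> X x -> V (z *: x)) -> addmul zs X U `<=` V.
Proof.
move=> hV UV; elim: zs => //= z zs IH h; apply: addS_sub => //.
  by move=> _ [x Xx <-]; apply: h; rewrite ?mem_head.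
by apply: IH => w x ws; apply: h; rewrite inE ws orbT.
Qed.

(** qY + V modulo qX + U is a quotient of a finite power of Y / X extended    *)
(** by V / U.                                                                 *)
Lemma chain_cond_addmul up zs X Y U V :
  submod X -> submod Y -> submod U -> submod V -> X `<=` Y -> U `<=` V ->
  chain_cond up X Y -> chain_cond up U V ->
  chain_cond up (addmul zs X U) (addmul zs Y V).
Proof.
move=> hX hY hU hV XY UV ccXY ccUV; elim: zs => //= z zs IH.
have hXz := submod_image (scale_linear z) hX.
have hYz := submod_image (scale_linear z) hY.
have hXU := submod_addmul zs hX hU; have hYV := submod_addmul zs hY hV.
have XYz : *:%R z @` X `<=` *:%R z @` Y.
  by move=> _ [x Xx <-]; exists x => //; apply: XY.
apply: (chain_cond_ext (C := addS ( *:%R z @` Y) (addmul zs X U))).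
- exact: submod_add.
- exact: submod_add.
- exact: addSS.
- apply: addSS => //; exact: addmulS.
- apply: (chain_cond_surj (scale_linear z) hY ccXY) => // [x Xx|].
    by apply: addSl; [case: hXU | exists x].
  move=> _ [_ [b [[x Yx <-] hb ->]]]; exists x => //.
  by rewrite addrC addKr; apply: addSr => //; exists 0; [case: hX | rewrite scaler0].
apply: (chain_cond_surj (@id_linear R M) hYV IH).
- exact: addmulS.
- by move=> x hx; apply: addSr => //; case: hYz.
move=> _ [a [b [ha hb ->]]]; exists b => //.
by rewrite addrK; apply: addSl => //; case: hXU.
Qed.
End FiniteGeneration.

(** * Complexes and cones *)

Section Complexes.
Context (R : comNzRingType).

(** All terms of a complex are submodules F n of one module D, which avoids   *)
(** casts between degrees; cohomology in degree n is never formed as a type,  *)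
(** it is the interval from [coboundaries d F n] to [cocycles d F n].         *)
Record complex (D : lmodType R) (d : D -> D) (F : int -> set D) : Prop := {
  cx_lin : linear d;
  cx_dd : forall x, d (d x) = 0;
  cx_sub : forall n, submod (F n);
  cx_deg : forall n x, F n x -> F (n + 1) (d x)
}.

Definition cocycles (D : lmodType R) (d : D -> D) (F : int -> set D) n : set D :=
  [set x | F n x /\ d x = 0].

Definition coboundaries (D : lmodType R) (d : D -> D) (F : int -> set D) n :
  set D := d @` F (n - 1).

(** The sign falls on the first copy, so that the second projection commutes with the
    differentials. *)
Definition cone_diff (D : lmodType R) (d : D -> D) (z : R) (x : D * D) : D * D :=
  (z *: x.2 - d x.1, d x.2).

Definition cone (D : lmodType R) (F : int -> set D) (n : int) : set (D * D)%type :=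
  [set x | F n x.1 /\ F (n + 1) x.2].

Lemma cone_complex (D : lmodType R) (d : D -> D) F z :
  complex d F -> complex (cone_diff d z) (cone F).
Proof.
move=> [dl dd Fs Fd]; split.
- move=> a x y; rewrite /cone_diff /= !dl; congr (_, _); rewrite /= scalerBr.
  by rewrite scalerDr opprD !scalerA [z * a]mulrC addrACA.
- move=> x; rewrite /cone_diff /= dd linB // linZ // dd subr0 subrr.
  by [].
- move=> n; split=> [|a x y [Fx Fx'] [Fy Fy']].
    by split; case: (Fs n) (Fs (n + 1)) => ? _ [].
  by split; apply: (Fs _).2.
move=> n x [F1 F2]; split=> /=; last exact: Fd.
by apply: (submod_sub (Fs _)); [apply: submodZ | apply: Fd].
Qed.

Section Cocycles.
Context (D : lmodType R) (d : D -> D) (F : int -> set D).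
Hypothesis hF : complex d F.
Let dl := cx_lin hF.
Let Fs := cx_sub hF.
Local Notation Z := (cocycles d F).
Local Notation B := (coboundaries d F).

Lemma submod_cocycles n : submod (Z n).
Proof.
split=> [|a x y [Fx dx] [Fy dy]]; first by split; [case: (Fs n) | apply: lin0].
by split; [apply: (Fs n).2 | rewrite dl dx dy scaler0 addr0].
Qed.

Lemma submod_coboundaries n : submod (B n).
Proof. exact: submod_image. Qed.

Lemma coboundaries_sub n : B n `<=` Z n.
Proof.
move=> _ [x Fx <-]; split; last exact: (cx_dd hF).
by rewrite -[n](subrK 1); apply: (cx_deg hF).
Qed.

Lemma coboundaryS n x : F n x -> B (n + 1) (d x).
Proof. by move=> Fx; exists x; rewrite ?addrK. Qed.

End Cocycles.

Section Cone.
Context (D : lmodType R) (d : D -> D) (F : int -> set D).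
Hypothesis hF : complex d F.
Variable z : R.
Let dl := cx_lin hF.
Let Fs := cx_sub hF.
Local Notation Z := (cocycles d F).
Local Notation B := (coboundaries d F).
Local Notation dz := (cone_diff d z).
Local Notation Zc := (cocycles dz (cone F)).
Local Notation Bc := (coboundaries dz (cone F)).
Let hc := cone_complex z hF.
Let hZ := submod_cocycles hF.
Let hB := submod_coboundaries hF.
Let BZ := @coboundaries_sub _ _ _ hF.
Let hZc := submod_cocycles hc.
Let hBc := submod_coboundaries hc.
Let BZc := @coboundaries_sub _ _ _ hc.

Lemma cone_cocycleP n a b :
  Zc n (a, b) <-> [/\ F n a, Z (n + 1) b & z *: b = d a].
Proof.
split=> [[[/= Fa Fb] [/eqP]]|[Fa [Fb db] zb]].
  by rewrite subr_eq0 => /eqP e db; split.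
by split=> //; rewrite /cone_diff /= db zb subrr.
Qed.

Lemma cone_coboundaryP n a b :
  Bc n (a, b) <-> exists v w, [/\ F (n - 1) v, F n w, a = z *: w - d v & b = d w].
Proof.
split=> [[[v w] [/= Fv Fw] [<- <-]]|[v [w [Fv Fw -> ->]]]].
  by exists v, w; rewrite subrK in Fw.
by exists (v, w) => //; split=> //=; rewrite subrK.
Qed.

Lemma cone_cocycle_inl n a : Z n a -> Zc n (a, 0).
Proof.
by move=> [Fa da]; apply/cone_cocycleP; rewrite da scaler0; split=> //; case: (hZ (n + 1)).
Qed.

Lemma snd_linear : linear (@snd D D). Proof. by []. Qed.

Lemma inl_linear : linear (fun a : D => (a, 0 : D)).
Proof. by move=> c a b; congr (_, _); rewrite /= scaler0 addr0. Qed.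

(** The cocycles of the cone whose class comes from the cohomology of F.      *)
Definition coneC n : set (D * D)%type := [set x | Zc n x /\ B (n + 1) x.2].

Lemma submod_coneC n : submod (coneC n).
Proof. exact: submodI (hZc n) (submod_preimage snd_linear (hB (n + 1))). Qed.

Lemma cone_coboundary_coneC n : Bc n `<=` coneC n.
Proof.
move=> [a b] Bab; split; first exact: BZc.
by case/cone_coboundaryP: Bab => v [w [_ Fw _ ->]]; apply: coboundaryS.
Qed.

(** Exactness at H^n(cone): if b = d w, subtracting the coboundary (z w, d w) of (0, w) from (a, b)
    leaves a pair with second component 0. *)
Lemma coneC_decomp n x : coneC n x -> exists2 a, Z n a & Bc n (x - (a, 0)).
Proof.
case: x => a b [Zab [w /=]]; rewrite addrK => Fw bE.
have Bw : Bc n (z *: w, b).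
  by apply/cone_coboundaryP; exists 0, w; rewrite lin0 // subr0; case: (Fs (n - 1)).
have e : (a, b) - (a - z *: w, 0) = (z *: w, b).
  by congr (_, _); rewrite /= ?subr0 // opprB addrC subrK.
exists (a - z *: w); last by rewrite e.
have [_ [/eqP]] : Zc n ((a, b) - (z *: w, b)) by apply: submod_sub => //; apply: BZc.
rewrite /= !subrr scaler0 sub0r oppr_eq0 => /eqP da _; split=> //.
case: Zab => -[/= Fa _] _; apply: (submod_sub (Fs n)) => //; exact: submodZ.
Qed.

Lemma chain_cond_coneC up n :
  chain_cond up (B (n + 1)) (Z (n + 1)) -> chain_cond up (coneC n) (Zc n).
Proof.
move=> cc; apply: (chain_cond_inj snd_linear _ _ _ cc) => //.
by move=> [a b] /cone_cocycleP[].
Qed.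

(** H^n(cone) is an extension, with middle term [coneC], of a submodule of H^(n+1)(F) by a quotient
    of H^n(F). *)
Lemma chain_cond_cone up n :
  chain_cond up (B n) (Z n) -> chain_cond up (B (n + 1)) (Z (n + 1)) ->
  chain_cond up (Bc n) (Zc n).
Proof.
move=> cc0 cc1; apply: (chain_cond_ext (C := coneC n)) => //.
- exact: submod_coneC.
- exact: cone_coboundary_coneC.
- by move=> x [].
- apply: (chain_cond_surj inl_linear (hZ n) cc0) => //; last exact: coneC_decomp.
  move=> _ [v Fv <-]; apply/cone_coboundaryP; exists (- v), 0.
  rewrite scaler0 sub0r linN // opprK lin0 //.
  by split=> //; [apply: submodN | case: (Fs n)].
exact: chain_cond_coneC.
Qed.

(** A cocycle b with z b = d a lifts to the cocycle (a, b) of the cone. This supplies the hypothesis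
    of [dcc_torsion]. *)
Lemma chain_cond_cone_kernel up n : chain_cond up (Bc n) (Zc n) ->
  chain_cond up (B (n + 1)) [set b | Z (n + 1) b /\ B (n + 1) (z *: b)].
Proof.
move=> cc; apply: (chain_cond_surj snd_linear (hZc n) cc) => //.
  by move=> [a b] /cone_coboundary_coneC[].
move=> b [Zb [a /=]]; rewrite addrK => Fa da; exists (a, b); last first.
  by rewrite subrr; case: (hB (n + 1)).
exact/cone_cocycleP.
Qed.

(** With X = H^n(F), Y = H^n(cone) and N a submodule of H^(n+1)(F), the exact *)
(** sequence 0 -> X / zX -> Y -> N -> 0 makes X / (z, zs)X an extension of a  *)
(** submodule of Y / (zs)Y by a quotient of Tor_1(R / (zs), N); the latter is *)
(** replaced by a quotient of a power of N.                                   *)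
Lemma chain_cond_cone_quotient up zs n :
  chain_cond up (B (n + 1)) (Z (n + 1)) ->
  chain_cond up (addmul zs (Zc n) (Bc n)) (Zc n) ->
  chain_cond up (addmul (z :: zs) (Z n) (B n)) (Z n).
Proof.
move=> ccN ccY; have hC := submod_coneC n.
have CZ : coneC n `<=` Zc n by move=> x [].
have ZY : addmul zs (Zc n) (Bc n) `<=` Zc n.
  by apply: addmul_sub => // w x _; apply: submodZ.
have sub : addmul zs (coneC n) (Bc n) `<=` addmul zs (Zc n) (Bc n).
  exact: addmulS.
have {ccN ccY} cc : chain_cond up (addmul zs (coneC n) (Bc n)) (Zc n).
  apply: chain_cond_ext ccY => //; first exact: submod_addmul.
  (* The cokernel of (zs)[coneC] in (zs)Y comes from a power of Y / [coneC], which embeds in N; this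
     replaces the Tor term. *)
  apply: chain_cond_addmul => //; first exact: chain_cond_coneC.
  exact: chain_cond_triv.
apply: (chain_cond_inj inl_linear _ _ _ cc) => //.
- exact: submod_addmul.
- exact: subset_trans ZY.
- exact: cone_cocycle_inl.
pose X := addmul zs (Z n) (B n).
have hX : submod X by apply: submod_addmul.
pose L : set (D * D)%type :=
  addS [set x | addmul zs (Z n) [set 0] x.1 /\ x.2 = 0] (Bc n).
suff hL : addmul zs (coneC n) (Bc n) `<=` L.
  have sub0 : addmul zs (Z n) [set 0] `<=` X.
    by apply: addmulS => // _ ->; case: (hB n).
  move=> a Za /hL [[a' b] [[v w] [/= [ha' ->] Bvw [-> ]]]].
  (* The coboundary has second component d t = 0, so t is a cocycle and z t - d u lies in z Z^n +
     B^n. *)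
  rewrite add0r => w0; case/cone_coboundaryP: Bvw => u [t [Fu Ft -> wE]].
  rewrite addrCA; exists (z *: t), (a' - d u); split=> //.
  - by exists t => //; split=> //; rewrite -wE.
  - apply: submod_sub => //.
      exact: sub0.
    by apply: addmul_base => //; exists u.
have hzero := submod_zero D.
have hA : submod (addmul zs (Z n) [set 0]) by apply: submod_addmul.
have hM : submod ([set x : D * D | addmul zs (Z n) [set 0] x.1 /\ x.2 = 0]).
  split=> [|c [x1 x2] [y1 y2] [/= hx ->] [/= hy ->]]; first by split; case: hA.
  by split=> /=; [apply: hA.2 | rewrite scaler0 addr0].
have hL : submod L by apply: submod_add.
apply: addmul_sub => //; first by apply: addSr; case: hM.
move=> w x ws /coneC_decomp[a Za Bxa].
rewrite -[x](subrK (a, 0)) addrC scalerDr; exists (w *: (a, 0)), (w *: (x - (a, 0))).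
split=> //; last exact: submodZ.
split; rewrite /= ?scaler0 //.
elim: (zs) ws => //= w' ws IH; rewrite inE => /predU1P[->|/IH h].
  apply: addSl; last by exists a.
  by have [] := submod_addmul ws (hZ n) hzero.
by apply: addSr => //; exists 0; rewrite ?scaler0; case: (hZ n).
Qed.

Definition torsion_cohomology (D' : lmodType R) (d' : D' -> D') (F' : int -> set D')
    (w : R) : Prop :=
  forall n v, cocycles d' F' n v -> exists e, coboundaries d' F' n (w ^+ e *: v).

(** The map (a, b) |-> (0, a) is a homotopy from multiplication by z to 0.    *)
Lemma cone_torsion_self : torsion_cohomology dz (cone F) z.
Proof.
move=> n [a b] /cone_cocycleP[Fa _ zb]; exists 1%N; apply/cone_coboundaryP.
exists 0, a; rewrite expr1 lin0 // subr0; split=> //; by case: (Fs (n - 1)).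
Qed.

(** A power of w makes the second component a coboundary; a further power kills the remaining class,
    which comes from H^n(F). *)
Lemma cone_torsion w : torsion_cohomology d F w -> torsion_cohomology dz (cone F) w.
Proof.
move=> tor n [a b] Zab; have [_ Zb _] := (cone_cocycleP _ _ _).1 Zab.
have [e Be] := tor _ _ Zb.
have /coneC_decomp[a' Za' Ba'] : coneC n (w ^+ e *: (a, b)).
  by split=> //; apply: submodZ.
have [e' [v Fv dv]] := tor _ _ Za'.
exists (e' + e)%N; rewrite exprD -scalerA -[w ^+ e *: _](subrK (a', 0)) scalerDr.
apply: submodD => //; first exact: submodZ.
apply/cone_coboundaryP; exists (- v), 0.
rewrite /= !scaler0 sub0r linN // opprK lin0 //.
by split=> //; [apply: submodN | case: (Fs n)].
Qed.
End Cone.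
End Complexes.

(** * Torsion with respect to a pair *)

Definition gen_ideal (R : comNzRingType) (zs : seq R) : set R^o :=
  extend [set (0 : R^o)] zs.

Lemma submod_gen_ideal (R : comNzRingType) (zs : seq R) : submod (gen_ideal zs).
Proof. by apply: submod_extend; apply: submod_zero. Qed.

Section PairTorsion.
Context (R : comNzRingType) (J : set R^o).
Hypothesis hJ : submod J.

(** Membership in Gamma_{(y),J}. One exponent suffices: y^N v = j v gives y^(N+1) v = (y j) v, and J
    is an ideal. *)
Definition pair_torsion (M : lmodType R) (y : R) (v : M) : Prop :=
  exists N, exists2 j : R, J j & y ^+ N *: v = j *: v.

Lemma submod_pair_torsion (M : lmodType R) y : submod (@pair_torsion M y).
Proof.
split=> [|a u v [N [j Jj ju]] [K [k Jk kv]]].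
  by exists 0%N, 0; [case: hJ | rewrite !scaler0].
(* The product (y^N - j)(y^K - k) kills a u + v; it is y^(N+K) minus this element of J. *)
exists (N + K)%N, (y ^+ N * k + y ^+ K * j - j * k).
  apply: (submod_sub hJ); first by apply: (submodD hJ); apply: (submodZ hJ).
  exact: (submodZ hJ).
have {}ju : (y ^+ N - j) *: u = 0 by rewrite scalerBl ju subrr.
have {}kv : (y ^+ K - k) *: v = 0 by rewrite scalerBl kv subrr.
have kill : ((y ^+ N - j) * (y ^+ K - k)) *: (a *: u + v) = 0.
  rewrite scalerDr -[X in _ + X]scalerA kv scaler0 addr0.
  by rewrite scalerA -mulrA mulrC -scalerA ju scaler0.
apply/eqP; rewrite -subr_eq0 -scalerBl -kill; apply/eqP; congr (_ *: _).
by rewrite exprD; ring.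
Qed.

(** Torsion means that some y^N - j annihilates the element, so only the annihilator matters. *)
Lemma pair_torsion_sub (M N : lmodType R) y (u : M) (v : N) :
  (forall r : R, r *: u = 0 -> r *: v = 0) -> pair_torsion y u -> pair_torsion y v.
Proof.
move=> uv [n [j Jj e]]; exists n, j => //; apply/eqP; rewrite -subr_eq0 -scalerBl.
by apply/eqP/uv; rewrite scalerBl e subrr.
Qed.

Lemma pair_torsion_pair (M : lmodType R) y (x : M * M) :
  pair_torsion y x <-> pair_torsion y x.1 /\ pair_torsion y x.2.
Proof.
case: x => a b; split=> [h|[/= ha hb]].
  by split; apply: pair_torsion_sub h => r; case.
have -> : (a, b) = (a, 0) + (0, b) by congr (_, _); rewrite /= ?addr0 ?add0r.
apply: (submodD (submod_pair_torsion _ _)).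
  by apply: pair_torsion_sub ha => r e; congr (_, _); rewrite /= ?scaler0.
by apply: pair_torsion_sub hb => r e; congr (_, _); rewrite /= ?scaler0.
Qed.

Lemma scale_exp_eq (M : lmodType R) (a b : R) (v : M) e :
  a *: v = b *: v -> a ^+ e *: v = b ^+ e *: v.
Proof.
move=> ab; elim: e => // e IH; rewrite exprSr -scalerA ab scalerA mulrC.
by rewrite -scalerA IH scalerA -exprS.
Qed.

(** This is the radical of (B : v). Induction on both exponents avoids the binomial formula: one
    factor r + s is split off, and v becomes r v and s v. *)
Lemma submod_radical (M : lmodType R) (B : set M) (v : M) :
  submod B -> submod [set r : R^o | exists e, B ((r : R) ^+ e *: v)].
Proof.
move=> hB; split=> [|a r s [e re] [f sf]].
  by exists 1%N; rewrite /= expr1 scale0r; case: hB.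
have {}re : B ((a * r) ^+ e *: v) by rewrite exprMn -scalerA; apply: submodZ.
exists (e + f)%N; rewrite -[a *: r]/(a * r); move: (a * r) re => {}r re.
elim: e f v re sf => [|e IHe] f v re sf.
  by apply: submodZ => //; rewrite -[v]scale1r.
elim: f v re sf => [|f IHf] v re sf.
  by apply: submodZ => //; rewrite -[v]scale1r.
rewrite addnS exprSr -scalerA scalerDl scalerDr; apply: submodD => //.
  rewrite addSnnS; apply: IHe; first by rewrite scalerA -exprSr.
  by rewrite scalerA mulrC -scalerA; apply: submodZ.
apply: IHf; last by rewrite scalerA -exprSr.
by rewrite scalerA mulrC -scalerA; apply: submodZ.
Qed.

(** * Torsion subcomplexes and their behaviour under cones *)

Section GammaComplex.
Context (D : lmodType R) (d : D -> D).

(** A list lets generators enter one at a time; when l generates I this is Gamma_{I,J}, by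
    [torsion_modP]. *)
Definition gamma (l : seq R) (F : int -> set D) n : set D :=
  [set x | F n x /\ forall y, y \in l -> pair_torsion y x].

Lemma gamma_complex l F : complex d F -> complex d (gamma l F).
Proof.
move=> [dl dd Fs Fd]; split=> // n.
  split=> [|a u v [Fu lu] [Fv lv]].
    by split=> [|y _]; [case: (Fs n) | case: (submod_pair_torsion D y)].
  split; first exact: (Fs n).2.
  by move=> y yl; apply: (submod_pair_torsion _ _).2; [apply: lu | apply: lv].
move=> x [Fx lx]; split; first exact: Fd.
move=> y /lx; apply: pair_torsion_sub => r rx.
by rewrite -linZ // rx lin0.
Qed.

Lemma gamma_nil F : gamma [::] F = F.
Proof. by apply/funext => n; apply/seteqP; split=> x // []. Qed.
End GammaComplex.

Lemma gamma_cone (D : lmodType R) l (F : int -> set D) :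
  gamma l (cone F) = cone (gamma l F).
Proof.
apply/funext => n; apply/seteqP; split=> -[a b] /=.
  by move=> [[Fa Fb] h]; split; split=> //= y /h /pair_torsion_pair[].
by move=> [[/= Fa ha] [/= Fb hb]]; split=> // y yl; apply/pair_torsion_pair; split;
  [apply: ha | apply: hb].
Qed.

(** The condition on annihilators makes divisibility pass to [gamma l F].     *)
Definition almost_divisible (D : lmodType R) (F : int -> set D) : Prop :=
  forall n x, F n x -> forall y : R, exists x' N,
    [/\ F n x', y ^+ N.+1 *: x' = y ^+ N *: x &
        forall r : R, r *: x = 0 -> r *: x' = 0].

Lemma cone_almost_divisible (D : lmodType R) (F : int -> set D) :
  almost_divisible F -> almost_divisible (cone F).
Proof.
move=> div n [a b] [/= /div Fa /div Fb] y.
have [a' [N [Fa' ea ha]]] := Fa y; have [b' [K [Fb' eb hb]]] := Fb y.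
have pad (u v : D) m k :
    y ^+ m.+1 *: u = y ^+ m *: v -> y ^+ (m + k).+1 *: u = y ^+ (m + k) *: v.
  move=> e; rewrite -addSn -[(m.+1 + k)%N]addnC exprD -scalerA e.
  by rewrite scalerA -exprD addnC.
exists (a', b'), (N + K)%N; split=> //.
  by congr (_, _) => /=; [|rewrite addnC]; apply: pad.
by move=> r [/ha ra /hb rb]; congr (_, _).
Qed.

(** The complex F / G has no cohomology.                                      *)
Definition acyclic_mod (D : lmodType R) (d : D -> D) (F G : int -> set D) : Prop :=
  forall n x, F n x -> G (n + 1) (d x) -> exists2 y, F (n - 1) y & G n (x - d y).

Section Acyclic.
Context (D : lmodType R) (d : D -> D) (F G : int -> set D).
Hypotheses (hF : complex d F) (hG : complex d G) (GF : forall n, G n `<=` F n).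
Let dl := cx_lin hF.
Let Fs := cx_sub hF.
Let Gs := cx_sub hG.

Lemma acyclic_trans (H : int -> set D) :
  (forall n, H n `<=` G n) ->
  acyclic_mod d F G -> acyclic_mod d G H -> acyclic_mod d F H.
Proof.
move=> HG aFG aGH n x Fx Hdx; have [y Fy Gxy] := aFG n x Fx (HG _ _ Hdx).
have [|t Gt Ht] := aGH n _ Gxy.
  by rewrite linB // (cx_dd hF) subr0.
exists (y + t); first by apply: submodD => //; apply: GF.
by rewrite linD // opprD addrA.
Qed.

(** First b is corrected by some d y, then a - z y by some d t; the sign in [cone_diff] turns t into
    -t. *)
Lemma acyclic_cone z :
  acyclic_mod d F G -> acyclic_mod (cone_diff d z) (cone F) (cone G).
Proof.
move=> aFG n [a b] [/= Fa Fb] [/= Ga Gb].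
have [y Fy Gy] := aFG _ _ Fb Gb; rewrite addrK in Fy.
have [||t Ft Gt] := aFG n (a - z *: y) => //.
- by apply: submod_sub => //; apply: submodZ.
- rewrite linB // linZ //; have := submod_sub (Gs _) (submodZ (Gs _) z Gy) Ga.
  by rewrite scalerBr opprB [X in G _ X]addrC addrA subrK.
exists (- t, y); split; rewrite /= ?subrK //; first exact: submodN.
by rewrite (linN dl) opprK opprD addrA.
Qed.

(** Multiplication by z is bijective on F / G, so its cone is acyclic.        *)
Lemma acyclic_cone_self z :
  (forall n x, F n x -> G n (z *: x) -> G n x) ->
  (forall n x, F n x -> exists2 x', F n x' & G n (z *: x' - x)) ->
  acyclic_mod (cone_diff d z) (cone F) (cone G).
Proof.
move=> zinj zsurj n [a b] [/= Fa Fb] [/= Ga _].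
have [w Fw Gw] := zsurj _ _ Fa.
have Gaw : G n (a - z *: w) by rewrite -opprB; apply: submodN.
exists (0, w); rewrite /cone_diff /=; first by split; rewrite ?subrK //; case: (Fs (n - 1)).
split; rewrite /= ?(lin0 dl) ?subr0 //.
apply: zinj; first by apply: (submod_sub (Fs _)) => //; apply: (cx_deg hF).
have := submodD (Gs _) Ga (cx_deg hG Gaw).
by rewrite linB // linZ // addrA subrK -scalerBr.
Qed.

(** H^n(G) embeds in H^n(F): if d v lies in G, a coboundary moves v into G without changing d v. *)
Lemma chain_cond_acyclic up n : acyclic_mod d F G ->
  chain_cond up (coboundaries d F n) (cocycles d F n) ->
  chain_cond up (coboundaries d G n) (cocycles d G n).
Proof.
move=> aFG; apply: (chain_cond_sub (submod_coboundaries hF n)).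
- exact: submod_cocycles.
- exact: submod_cocycles.
- exact: coboundaries_sub.
- by move=> x [Gx dx]; split=> //; apply: GF.
move=> x [Gx _] [v Fv dv]; rewrite -{x}dv in Gx *.
have [|y Fy Gy] := aFG _ v Fv; first by rewrite subrK.
exists (v - d y) => //; by rewrite linB // (cx_dd hF) subr0.
Qed.
End Acyclic.

(** What a cone over w achieves and later cones preserve: imposing w-torsion on [gamma l F] does not
    change its cohomology, which is itself w-torsion. All lists l are needed for the induction in
    [resolved_acyclic]. *)
Definition resolved (D : lmodType R) (d : D -> D) (F : int -> set D) (w : R) : Prop :=
  forall l, acyclic_mod d (gamma l F) (gamma (w :: l) F) /\
            torsion_cohomology d (gamma l F) w.

Lemma gamma_cons_sub (D : lmodType R) w l (F : int -> set D) n :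
  gamma (w :: l) F n `<=` gamma l F n.
Proof. by move=> x [Fx h]; split=> // y yl; apply: h; rewrite inE yl orbT. Qed.

Lemma gamma_consP (D : lmodType R) w l (F : int -> set D) n x :
  gamma l F n x -> pair_torsion w x -> gamma (w :: l) F n x.
Proof. by move=> [Fx h] wx; split=> // y; rewrite inE => /predU1P[->//|/h]. Qed.

Section Resolved.
Context (D : lmodType R) (d : D -> D) (F : int -> set D).
Hypothesis hF : complex d F.

Lemma cone_resolved z w : resolved d F w -> resolved (cone_diff d z) (cone F) w.
Proof.
move=> res l; have [ac tor] := res l; rewrite !gamma_cone; split.
  by apply: acyclic_cone ac; try exact: gamma_complex.
by apply: cone_torsion tor; apply: gamma_complex.
Qed.

(** Multiplication by z is bijective on [gamma l F] modulo [gamma (z :: l) F]: z^N (z x) = j (z x)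
    reads z^(N+1) x = (z j) x, and almost divisibility gives preimages, which stay in [gamma l F] by
    the condition on annihilators. *)
Lemma cone_resolved_self z :
  almost_divisible F -> resolved (cone_diff d z) (cone F) z.
Proof.
move=> div l; rewrite !gamma_cone; split; last first.
  by apply: cone_torsion_self; apply: gamma_complex.
apply: acyclic_cone_self; try exact: gamma_complex.
  move=> n x hx [_ /(_ z (mem_head _ _))[N [j Jj e]]]; apply: gamma_consP => //.
  exists N.+1, (z * j); first exact: (submodZ hJ).
  by rewrite exprSr -scalerA e scalerA mulrC.
move=> n x [Fx hx]; have [x' [N [Fx' e ann]]] := div n x Fx z.
have lx' : gamma l F n x'.
  by split=> // y /hx; apply: pair_torsion_sub.
exists x' => //; apply: gamma_consP.
  have hl := cx_sub (gamma_complex l hF) n.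
  by apply: submod_sub => //; apply: submodZ.
exists N, 0; first by case: hJ.
by rewrite scalerBr scalerA -exprSr e subrr scale0r.
Qed.

Lemma resolved_acyclic (ws l : seq R) :
  {subset l <= ws} -> (forall w, w \in ws -> resolved d F w) ->
  acyclic_mod d F (gamma l F).
Proof.
move=> lw res; elim: l lw => [_|y l IH lw].
  rewrite gamma_nil => n x Fx _; exists 0; first by case: (cx_sub hF (n - 1)).
  by rewrite lin0 ?subr0 //; apply: (cx_lin hF).
apply: (@acyclic_trans D d F (gamma l F) hF).
- by move=> n x [].
- exact: gamma_cons_sub.
- by apply: IH => w wl; apply: lw; rewrite inE wl orbT.
by have [] := res y (lw y (mem_head _ _)) l.
Qed.

(** The cohomology embeds in that of F, which is Noetherian and torsion for each element of ms. Its
    part killed by ms is finitely generated over the Artinian ring R / (ms), so Melkersson's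
    criterion applies. *)
Lemma resolved_dcc (ms ys : seq R) :
  (forall n, chain_cond true (coboundaries d F n) (cocycles d F n)) ->
  chain_cond false (gen_ideal ms) setT ->
  (forall w, w \in ms -> resolved d F w) -> {subset ys <= ms} ->
  forall n, chain_cond false (coboundaries d (gamma ys F) n)
                             (cocycles d (gamma ys F) n).
Proof.
move=> acc dccm res ym n.
apply: (chain_cond_acyclic hF (gamma_complex ys hF)).
- by move=> k x [].
- exact: resolved_acyclic ym res.
have hB := submod_coboundaries hF n; have hZ := submod_cocycles hF n.
have BZ := coboundaries_sub hF (n := n).
apply: (dcc_torsion_seq (ys := ms)) => //.
  by move=> y v /res/(_ [::])[_]; rewrite gamma_nil; apply.
set V := [set v | _]; have hV : submod V.
  split=> [|a u v [Bu Au] [Bv Av]].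
    by split=> [|y _]; rewrite ?scaler0; [case: hZ | case: hB].
  split=> [|y ym']; first exact: hZ.2.
  rewrite scalerDr scalerA mulrC -scalerA.
  by apply: hB.2; [apply: Au | apply: Av].
have BV : coboundaries d F n `<=` V.
  by move=> v Bv; split=> [|y _]; [apply: BZ | apply: submodZ].
apply: (acc_dcc hB hV BV (submod_gen_ideal ms) dccm).
  move=> r v rm [_ Av].
  have hP : submod [set r : R^o | coboundaries d F n ((r : R) *: v)].
    by apply: submod_preimage hB => a b c; rewrite scalerDl scalerA.
  apply: (extend_sub hP) rm => // _ ->; rewrite /= scale0r; by case: hB.
apply: chain_cond_sub (acc n) => //; by move=> x [].
Qed.
End Resolved.

(** Descend along the cones over the generators zs of I that remain: the      *)
(** cohomology of gamma F is torsion with respect to each of them.            *)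
Lemma dcc_gamma (xs ys : seq R) :
  (forall j, J j -> gen_ideal xs j) ->
  chain_cond false (gen_ideal (xs ++ ys)) setT ->
  forall (zs ws : seq R) (D : lmodType R) (d : D -> D) (F : int -> set D),
  complex d F -> almost_divisible F ->
  (forall n, chain_cond true (coboundaries d F n) (cocycles d F n)) ->
  (forall w, w \in ws -> resolved d F w) ->
  {subset xs <= ws} -> {subset ys <= ws ++ zs} -> {subset zs <= ys} ->
  forall n, chain_cond false (coboundaries d (gamma ys F) n)
                             (cocycles d (gamma ys F) n).
Proof.
move=> Jxs dccm; elim=> [|z zs IH] ws D d F hF div acc res xw yw zy.
  apply: (resolved_dcc hF acc dccm) => [w|y yy]; last by rewrite mem_cat yy orbT.
  by rewrite cats0 in yw; rewrite mem_cat => /orP[/xw|/yw]; apply: res.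
have hG := gamma_complex ys hF.
have {IH} dccC n : chain_cond false
    (coboundaries (cone_diff d z) (cone (gamma ys F)) n)
    (cocycles (cone_diff d z) (cone (gamma ys F)) n).
  rewrite -gamma_cone; apply: (IH (z :: ws)).
  - exact: cone_complex.
  - exact: cone_almost_divisible.
  - by move=> k; apply: chain_cond_cone.
  - move=> w; rewrite inE => /predU1P[->|/res]; first exact: cone_resolved_self.
    exact: cone_resolved.
  - by move=> x /xw xs'; rewrite inE xs' orbT.
  - by move=> y /yw; rewrite !mem_cat !inE orbCA orbA.
  - by move=> y yz; apply: zy; rewrite inE yz orbT.
move=> n; apply: (dcc_torsion (y := z)).
- exact: submod_coboundaries.
- exact: submod_cocycles.
- exact: coboundaries_sub.
- move=> v Zv; have [[_ /(_ z (zy z (mem_head _ _)))[N [j Jj e]]] _] := Zv.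
  (* The class of v is torsion for each generator of (xs), hence for j since the radical is an
     ideal; then z^(N k) v = j^k v is a coboundary. *)
  have : gen_ideal xs j by apply: Jxs.
  have hB := submod_coboundaries hG n.
  move=> /(extend_sub (submod_radical v hB)).
  case=> [_ ->|w /xw/res/(_ ys)[_]|k Bk].
  + by exists 1%N; rewrite expr1 scale0r; case: hB.
  + exact.
  by exists (N * k)%N; rewrite exprM (scale_exp_eq _ e).
by have := chain_cond_cone_kernel hG (dccC (n - 1)); rewrite subrK.
Qed.

(** Induction on the list zs of cones still to be taken. A cone in degree i involves only degrees i
    and i + 1 of F, so the hypothesis above c persists; at the end [dcc_gamma] applies. *)
Lemma dcc_gamma_quotient (xs ys : seq R) :
  (forall j, J j -> gen_ideal xs j) ->
  chain_cond false (gen_ideal (xs ++ ys)) setT ->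
  forall (zs ws : seq R) (D : lmodType R) (d : D -> D) (F : int -> set D) (c : int),
  complex d F -> almost_divisible F ->
  (forall n, chain_cond true (coboundaries d F n) (cocycles d F n)) ->
  (forall w, w \in ws -> resolved d F w) ->
  {subset xs <= ws ++ zs} ->
  (forall i, c < i -> chain_cond false (coboundaries d (gamma ys F) i)
                                       (cocycles d (gamma ys F) i)) ->
  chain_cond false
    (addmul zs (cocycles d (gamma ys F) c) (coboundaries d (gamma ys F) c))
    (cocycles d (gamma ys F) c).
Proof.
move=> Jxs dccm; elim=> [|z zs IH] ws D d F c hF div acc res xw dcc.
  rewrite cats0 in xw; apply: (dcc_gamma Jxs dccm hF div acc res xw (zs := ys)) => //.
  by move=> y yy; rewrite mem_cat yy orbT.
have hG := gamma_complex ys hF.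
apply: chain_cond_cone_quotient => //; first by apply: dcc; rewrite ltrDl.
rewrite -gamma_cone; apply: (IH (z :: ws)).
- exact: cone_complex.
- exact: cone_almost_divisible.
- by move=> k; apply: chain_cond_cone.
- move=> w; rewrite inE => /predU1P[->|/res]; first exact: cone_resolved_self.
  exact: cone_resolved.
- by move=> y /xw; rewrite !mem_cat !inE orbCA orbA.
move=> i ci; rewrite gamma_cone; apply: chain_cond_cone => //; apply: dcc => //.
by rewrite (lt_trans ci) // ltrDl.
Qed.
End PairTorsion.

(** * Ideals, quotients and injective modules *)

Section ClosedOfSubmod.
Context (R : comNzRingType) (M : lmodType R) (S : set M) (hS : submod S).

Definition closed_of_submod (_ : submod S) : {pred M} := fun x => `[< S x >].

Fact closed_of_submod_closed : submod_closed (closed_of_submod hS).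
Proof.
split=> [|a u v /asboolP Su /asboolP Sv]; apply/asboolP; first by case: hS.
exact: hS.2.
Qed.

HB.instance Definition _ :=
  GRing.isSubmodClosed.Build R M (closed_of_submod hS) closed_of_submod_closed.
End ClosedOfSubmod.

Section ClassicalModules.
Context (R : comNzRingType).

Lemma submod_closedP (M : lmodType R) (S : submodClosed M) :
  submod [set x | x \in S].
Proof. by split=> [|a x y Sx Sy]; rewrite /= ?rpred0 // rpredD ?rpredZ. Qed.

Lemma span_modP (M : lmodType R) (X S : set M) x :
  submod S -> X `<=` S -> x \in span_mod X -> S x.
Proof.
move=> hS XS /asboolP/(_ (closed_of_submod hS)) h; apply/asboolP/h => y Xy.
exact/asboolP/XS.
Qed.

Lemma mem_span_mod (M : lmodType R) (X : set M) x : X x -> x \in span_mod X.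
Proof. by move=> Xx; apply/asboolP => S; apply. Qed.

Lemma artinian_moduleP (M : lmodType R) :
  artinian_module M <-> chain_cond false [set (0 : M)] setT.
Proof.
split=> [art S hS cS|dcc S cS].
  have hs n : submod (S n) by case: (hS n).
  have [n x /asboolP Sx|N hN] := art (fun n => closed_of_submod (hs n)).
    exact/asboolP/cS.
  exists N => n /hN e; apply/seteqP; split=> x Sx; apply/asboolP.
    by rewrite -[_ (S N x)]/(x \in closed_of_submod (hs N)) -e; apply/asboolP.
  by rewrite -[_ (S n x)]/(x \in closed_of_submod (hs n)) e; apply/asboolP.
have [n|n|N hN] := dcc (fun n => [set x | x \in S n]).
- split=> //; first exact: submod_closedP.
  by move=> _ ->; apply: rpred0.
- exact: cS.
by exists N => n /hN/seteqP[h h'] x; apply/idP/idP; [apply: h | apply: h'].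
Qed.

Lemma noetherian_module_acc (M : lmodType R) :
  noetherian_module M -> chain_cond true [set (0 : M)] setT.
Proof.
move=> noeth S hS cS.
have hs n : submod (S n) by case: (hS n).
have [n x /asboolP Sx|N hN] := noeth (fun n => closed_of_submod (hs n)).
  exact/asboolP/cS.
exists N => n /hN e; apply/seteqP; split=> x Sx; apply/asboolP.
  by rewrite -[_ (S N x)]/(x \in closed_of_submod (hs N)) -e; apply/asboolP.
by rewrite -[_ (S n x)]/(x \in closed_of_submod (hs n)) e; apply/asboolP.
Qed.

Lemma finitely_generated_acc (M : lmodType R) :
  noetherian_ring R -> finitely_generated M ->
  chain_cond true [set (0 : M)] setT.
Proof.
move=> /noetherian_module_acc acc [s sM].
have h0 := submod_zero M.
have -> : [set: M] = extend [set 0] s.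
  apply/seteqP; split=> // x _; apply: span_modP (sM x) => //.
    exact: submod_extend.
  by move=> a; apply: mem_extend.
apply: (chain_cond_extend (submod_zero R^o)) => //.
by move=> a r _ ->; rewrite /set1 /= scale0r.
Qed.

Lemma ideal_fg (I : ideal R) : noetherian_ring R ->
  exists2 s : seq R, (forall a, a \in s -> a \in I) &
    forall a, a \in I -> gen_ideal s a.
Proof.
move=> /noetherian_module_acc acc.
have h0 := submod_zero R^o; have hI := submod_closedP I.
have I0 : [set (0 : R^o)] `<=` [set x | x \in I] by move=> _ ->; apply: rpred0.
have [|s sI Is] := acc_fg h0 hI I0; last by exists s.
exact: chain_cond_sub acc.
Qed.

Definition linear_of (M N : lmodType R) (f : M -> N) (flin : linear f) :
  {linear M -> N} := HB.pack f (GRing.isLinear.Build R M N *:%R f flin).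

Lemma quotient_lift (M N : lmodType R) (S : submodClosed M) (f : M -> N) :
  linear f -> (forall x, x \in S -> f x = 0) ->
  exists g : {linear quotient_module S -> N}, forall x, g (qm_pi S x) = f x.
Proof.
move=> flin fS.
have fpi x y : qm_pi S x = qm_pi S y -> f x = f y.
  move/eqP; rewrite qm_piP => /fS; rewrite (linB flin) => /eqP.
  by rewrite subr_eq0 => /eqP.
have piK (q : quotient_module S) : qm_pi S (repr q) = q by apply: reprK.
have glin : linear (fun q : quotient_module S => f (repr q)).
  by move=> a u v; rewrite -flin; apply: fpi; rewrite linearP /= !piK.
by exists (linear_of glin) => x /=; apply: fpi; rewrite piK.
Qed.

Lemma qm_pi_eq0 (M : lmodType R) (S : submodClosed M) x :
  (qm_pi S x == 0) = (x \in S).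
Proof. by rewrite -(linear0 (qm_pi S)) qm_piP subr0. Qed.

Lemma artinian_quotient_dcc (M : lmodType R) (S : submodClosed M) :
  artinian_module (quotient_module S) -> chain_cond false [set x | x \in S] setT.
Proof.
move=> /artinian_moduleP dcc.
apply: (chain_cond_inj (f := qm_pi S) _ _ _ _ dcc) => //.
- exact: linearP.
- exact: submod_zero.
by move=> w _ /eqP; rewrite qm_pi_eq0.
Qed.

Lemma scaler_linear (M : lmodType R) (x : M) : linear (fun r : R^o => (r : R) *: x).
Proof. by move=> a r s; rewrite scalerDl scalerA. Qed.

(** If (ann x : y^(N+1)) = (ann x : y^N), then multiplication by y^(N+1)      *)
(** embeds R / (ann x : y^N) into R / ann x, and the map r |-> r y^N x        *)
(** extends along it.                                                         *)
Lemma injective_divisible (E : lmodType R) (x : E) (y : R) :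
  noetherian_ring R -> injective_module E ->
  exists x' N, y ^+ N.+1 *: x' = y ^+ N *: x /\ forall r : R, r *: x = 0 -> r *: x' = 0.
Proof.
move=> noeth inj.
have mlin n : linear (fun r : R^o => (y ^+ n * r : R^o)).
  by move=> a r s; rewrite mulrDr [a *: r]/(a * r) mulrCA.
have glin n : linear (fun r : R^o => (y ^+ n * r) *: x).
  by move=> a r s; rewrite mlin scalerDl [a *: (_ * r)]/(a * _) scalerA.
pose K n : submodClosed R^o := ker_mod (linear_of (glin n)).
have KE n r : (r \in K n) = ((y ^+ n * r) *: x == 0) by [].
have [|N hN] := noeth K.
  move=> n r; rewrite !KE exprS => /eqP e.
  by rewrite -mulrA -scalerA e scaler0.
have {}hN := hN N.+1 (leqnSn N).
have [|g gE] := quotient_lift (S := K N) (glin N); first by move=> r /eqP.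
pose A : submodClosed R^o := K 0.
have AE r : (r \in A) = (r *: x == 0) by rewrite KE mul1r.
have flin : linear (fun r : R^o => qm_pi A (y ^+ N.+1 * r)).
  by move=> a r s; rewrite mlin linearP.
have [|f fE] := quotient_lift (S := K N) flin.
  by move=> r; rewrite -hN KE => e; apply/eqP; rewrite qm_pi_eq0 AE.
have finj : injective f.
  move=> u v; elim/qm_piW: u => r; elim/qm_piW: v => s e.
  apply/eqP; rewrite qm_piP -hN KE -AE -qm_pi_eq0 -fE linearB linearB /= e.
  by rewrite subrr.
have [h hE] := inj _ _ f g finj.
have hpi r : r *: h (qm_pi A 1) = h (qm_pi A r).
  by rewrite -linearZ -linearZ /= [r *: 1]mulr1.
(* This is the image of 1 under a map from R / ann x, hence it is killed by ann x. *)
exists (h (qm_pi A 1)), N; split=> [|r rx].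
  by rewrite hpi -[_ ^+ _]mulr1 -fE hE gE mulr1.
rewrite hpi; have /eqP -> : qm_pi A r == 0 by rewrite qm_pi_eq0 AE rx.
exact: linear0.
Qed.

(** For an ideal C this says that I^n lies in C, unfolded into colon ideals: 1 is in (C : a_1 ...
    a_n) for all a_i in I. *)
Fixpoint power_in (I C : set R) (n : nat) : Prop :=
  if n is n'.+1 then forall a, I a -> power_in I [set r | C (a * r)] n' else C 1.

Lemma power_inS (I C C' : set R) n : C `<=` C' -> power_in I C n -> power_in I C' n.
Proof.
elim: n C C' => [|n IH] C C' CC /=; first exact: CC.
by move=> h a /h; apply: IH => r /CC.
Qed.

Lemma power_inI (I C C' : set R) n :
  power_in I C n -> power_in I C' n -> power_in I (C `&` C') n.
Proof.
elim: n C C' => [|n IH] C C' //= h h' a Ia.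
exact: IH (h a Ia) (h' a Ia).
Qed.

Lemma submod_colon (C : set R^o) (a : R) :
  submod C -> submod [set r : R^o | C (a * (r : R))].
Proof.
move=> hC; apply: submod_preimage hC => b r s.
by rewrite mulrDr [b *: r]/(b * r) mulrCA.
Qed.

Lemma power_in_unit (I : set R) (C : set R^o) n : submod C -> C 1 -> power_in I C n.
Proof.
elim: n C => //= n IH C hC C1 a _; apply: IH; first exact: submod_colon.
by have := submodZ hC a C1.
Qed.

(** One factor r y + b is split off: passing to (C : y) lowers n, passing to (C : b) lowers m. *)
Lemma power_in_extend (I : set R) (y : R) (n m : nat) (C : set R^o) :
  submod C -> C (y ^+ n) -> power_in I C m ->
  power_in [set a | exists r b, I b /\ a = r * y + b] C (n + m).
Proof.
elim: n m C => [|n IHn] m C hC Cy Cm; first exact: power_in_unit.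
elim: m C hC Cy Cm => [|m IHm] C hC Cy Cm; first exact: power_in_unit.
rewrite addSn /= => _ [r [b [Ib ->]]].
have hy := submod_colon y hC; have hb := submod_colon b hC.
have h1 : power_in [set a | exists r b, I b /\ a = r * y + b]
    [set s | C (y * s)] (n + m.+1).
  apply: IHn => //; first by rewrite /= -exprS.
  by apply: power_inS Cm => s Cs; exact: (@submodZ _ _ _ hC y s Cs).
have h2 : power_in [set a | exists r b, I b /\ a = r * y + b]
    [set s | C (b * s)] (n + m.+1).
  rewrite addnS -addSn; apply: IHm => //; last exact: Cm.
  exact: (submodZ hC b Cy).
apply: power_inS (power_inI h1 h2) => s [Cys Cbs] /=.
rewrite mulrDl -mulrA; apply: (submodD hC) => //; exact: (submodZ hC r Cys).
Qed.

Lemma power_in_gen_ideal (ys : seq R) (C : set R^o) :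
  submod C -> (forall y, y \in ys -> exists n, C (y ^+ n)) ->
  exists n, power_in (gen_ideal ys) C n.
Proof.
move=> hC; elim: ys => [|y ys IH] h.
  exists 1%N => /= _ ->; by rewrite mul0r; case: hC.
have [n Cy] := h y (mem_head _ _).
have [|m Cm] := IH; first by move=> z zs; apply: h; rewrite inE zs orbT.
by exists (n + m)%N; apply: power_in_extend.
Qed.

Lemma ideal_exp_power_in (I : ideal R) n (C : set R^o) r : submod C ->
  power_in [set a | a \in I] C n -> r \in ideal_exp I n -> C r.
Proof.
elim: n C r => [|n IH] C r hC /= h.
  by move=> _; have := submodZ hC r h; rewrite [_ *: _]mulr1.
apply: (span_modP hC) => _ [a [b [Ia Ib ->]]].
by apply: IH (submod_colon a hC) (h a Ia) Ib.
Qed.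

Lemma exp_in_ideal_exp (I : ideal R) (y : R) n : y \in I -> y ^+ n \in ideal_exp I n.
Proof.
move=> yI; elim: n => [|n IH]; first exact: mem_span_mod.
by apply: mem_span_mod; exists y, (y ^+ n); rewrite exprS.
Qed.

(** If the ideal ann x + J contains a power of each of the finitely many generators of I, it
    contains a power of I. *)
Lemma torsion_modP (I J : ideal R) (ys : seq R) (M : lmodType R) (x : M) :
  (forall y, y \in ys -> y \in I) -> (forall a, a \in I -> gen_ideal ys a) ->
  x \in @torsion_mod R I J M <->
  forall y, y \in ys -> pair_torsion [set j | j \in J] y x.
Proof.
move=> ysI Iys; split=> [/asboolP[N h] y /ysI yI|h].
  have [j jJ e] := h N (leqnn N) _ (exp_in_ideal_exp N yI).
  by exists N, j.
have [|N hN] := @power_in_gen_ideal ys _ (submod_closedP (ann_plus J x)).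
  by move=> y /h[n [j Jj e]]; exists n; apply/asboolP; exists j.
apply/asboolP; exists N => n Nn a aI.
suff : a \in ann_plus J x by move=> /asboolP.
apply: (ideal_exp_power_in (submod_closedP (ann_plus J x)) _ aI).
have hle : power_in (gen_ideal ys) [set r : R^o | r \in ann_plus J x] n.
  rewrite -(subnK Nn); elim: (n - N)%N => //= k IH b _.
  apply: power_inS IH => r /= h'; exact: (submodZ (submod_closedP _) b h').
have mono (I1 I2 : set R) k C : I1 `<=` I2 -> power_in I2 C k -> power_in I1 C k.
  by move=> II; elim: k C => //= k IH C h' b /II/h'; apply: IH.
by apply: mono hle => b; apply: Iys.
Qed.
End ClassicalModules.

(** * The complex of a resolution *)

Section TotalModule.
Context (R : comNzRingType) (E : nat -> lmodType R).

(** The product of all terms, so that the resolution becomes a [complex] inside one module; degrees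
    are cut out by supports. *)
Definition total_module : Type := forall n, E n.

HB.instance Definition _ := gen_eqMixin total_module.
HB.instance Definition _ := gen_choiceMixin total_module.

Definition total_zero : total_module := fun=> 0.
Definition total_opp (f : total_module) : total_module := fun n => - f n.
Definition total_add (f g : total_module) : total_module := fun n => f n + g n.
Definition total_scale (a : R) (f : total_module) : total_module := fun n => a *: f n.

Lemma totalP (f g : total_module) : (forall n, f n = g n) -> f = g.
Proof. exact: functional_extensionality_dep. Qed.

Fact total_addA : associative total_add.
Proof. by move=> f g h; apply: totalP => n; apply: addrA. Qed.
Fact total_addC : commutative total_add.
Proof. by move=> f g; apply: totalP => n; apply: addrC. Qed.
Fact total_add0 : left_id total_zero total_add.
Proof. by move=> f; apply: totalP => n; apply: add0r. Qed.
Fact total_addN : left_inverse total_zero total_opp total_add.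
Proof. by move=> f; apply: totalP => n; apply: addNr. Qed.

HB.instance Definition _ := GRing.isZmodule.Build total_module
  total_addA total_addC total_add0 total_addN.

Fact total_scaleA a b f : total_scale a (total_scale b f) = total_scale (a * b) f.
Proof. by apply: totalP => n; apply: scalerA. Qed.
Fact total_scale1 : left_id 1 total_scale.
Proof. by move=> f; apply: totalP => n; apply: scale1r. Qed.
Fact total_scaleDr : right_distributive total_scale +%R.
Proof. by move=> a f g; apply: totalP => n; apply: scalerDr. Qed.
Fact total_scaleDl f : {morph total_scale^~ f : a b / a + b}.
Proof. by move=> a b; apply: totalP => n; apply: scalerDl. Qed.

HB.instance Definition _ := GRing.Zmodule_isLmodule.Build R total_module
  total_scaleA total_scale1 total_scaleDr total_scaleDl.

Definition inj_total n (x : E n) : total_module := dfwith (fun k => 0 : E k) x.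

Lemma inj_total_in n (x : E n) : inj_total x n = x.
Proof. exact: dfwith_in. Qed.

Lemma inj_total_out n (x : E n) k : n != k -> inj_total x k = 0.
Proof. exact: dfwith_out. Qed.

Lemma inj_total_linear n : linear (@inj_total n).
Proof.
move=> a x y; apply: totalP => k; rewrite -[RHS]/(a *: inj_total x k + inj_total y k).
have [<-|nk] := eqVneq n k; first by rewrite !inj_total_in.
by rewrite !inj_total_out // scaler0 addr0.
Qed.

Definition total_deg (n : int) : set total_module :=
  [set f | forall k : nat, k%:Z <> n -> f k = 0].

Lemma total_degP n (f : total_module) : total_deg n%:Z f -> f = inj_total (f n).
Proof.
move=> hf; apply: totalP => k; have [<-|nk] := eqVneq n k.
  by rewrite inj_total_in.
by rewrite inj_total_out // hf // => -[kn]; rewrite kn eqxx in nk.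
Qed.

Lemma inj_total_deg n (x : E n) : total_deg n%:Z (inj_total x).
Proof. by move=> k kn; apply: inj_total_out; apply/eqP => nk; apply: kn; rewrite nk. Qed.

Lemma total_deg_neg n (f : total_module) : total_deg (Negz n) f -> f = 0.
Proof. by move=> hf; apply: totalP => k; apply: hf. Qed.
End TotalModule.

Section ResolutionComplex.
Context (R : comNzRingType) (M : lmodType R) (E : injective_resolution M).

Definition total_diff (f : total_module E) : total_module E :=
  fun n => if n is m.+1 then ir_diff E m (f m) else 0.

Lemma total_diff_inj n (x : E n) :
  total_diff (inj_total x) = inj_total (ir_diff E n x).
Proof.
apply: totalP => -[|k] /=; first by rewrite inj_total_out.
have [<-|nk] := eqVneq n k; first by rewrite !inj_total_in.
by rewrite !inj_total_out ?eqSS // linear0.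
Qed.

Lemma resolution_complex : complex total_diff (@total_deg R E).
Proof.
split=> [a f g|f|n|n f hf].
- apply: totalP => -[|k].
    by rewrite -[RHS]/(a *: total_diff f 0%N + total_diff g 0%N) /= scaler0 addr0.
  rewrite -[RHS]/(a *: total_diff f k.+1 + total_diff g k.+1) /=.
  by rewrite -linearP.
- by apply: totalP => -[|[|k]] //=; [apply: linear0 | apply/ir_exactS; exists (f k)].
- split=> [|a f g hf hg] k kn //.
  by rewrite -[LHS]/(a *: f k + g k) hf // hg // scaler0 addr0.
move=> [|k] //= kn; rewrite hf ?linear0 // => e; apply: kn.
by rewrite -e -addn1 PoszD.
Qed.

Lemma resolution_almost_divisible :
  noetherian_ring R -> almost_divisible (@total_deg R E).
Proof.
move=> noeth [n|n] f hf y; last first.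
  by exists 0, 0%N; split=> [k||r _]; rewrite ?scaler0 // (total_deg_neg hf) scaler0.
have [x' [N [e ann]]] := injective_divisible (f n) y noeth (@ir_injective R M E n).
have lin := @inj_total_linear R E n.
exists (inj_total x'), N; split; first exact: inj_total_deg.
  by rewrite (total_degP hf) -!(linZ lin) e.
move=> r; rewrite [in X in X -> _](total_degP hf) -!(linZ lin) => h.
rewrite ann ?(lin0 lin) //.
by have := congr1 (fun g : total_module E => g n) h; rewrite inj_total_in.
Qed.

(** By exactness the cohomology is M in degree 0 and zero in all other degrees. *)
Lemma resolution_acc n : noetherian_ring R -> finitely_generated M ->
  chain_cond true (coboundaries total_diff (@total_deg R E) n)
                  (cocycles total_diff (@total_deg R E) n).
Proof.
move=> noeth fg; have hE := resolution_complex.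
have hB := submod_coboundaries hE n.
case: n hB => [[|n]|n] hB.
- have lin : linear (fun x : M => inj_total (ir_aug E x)).
    by move=> a x y; rewrite linearP; apply: inj_total_linear.
  apply: (chain_cond_surj lin _ (finitely_generated_acc noeth fg)) => //.
    by move=> _ ->; rewrite (lin0 lin); case: hB.
  move=> f [hf df]; have := congr1 (fun g : total_module E => g 1%N) df.
  move=> /(@ir_exact0 R M E _).1 [x xE]; exists x => //.
  by rewrite [f](total_degP hf) xE subrr; case: hB.
- apply: chain_cond_triv => f [hf df].
  have /(@ir_exactS R M E _ _).1 [x xE] := congr1 (fun g : total_module E => g n.+2) df.
  rewrite (total_degP hf) -xE -total_diff_inj; exists (inj_total x) => //.
  rewrite -[n.+1]addn1 PoszD addrK; exact: inj_total_deg.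
- apply: chain_cond_triv => f [hf _].
  by rewrite (total_deg_neg hf); case: hB.
Qed.
End ResolutionComplex.

(** * The graded case *)

Section Graded.
Context (R : comNzRingType) (G : ring_grading R) (m0 : ideal (base_ring G)).
Local Notation I := (irrelevant G).
Local Notation J := (base_smul m0 R^o).

Lemma maximal_ideal_inv (A : comNzRingType) (m : ideal A) (a : A) :
  maximal_ideal m -> a \notin m -> exists u, 1 - u * a \in m.
Proof.
move=> [m1 mmax] am.
have hm := submod_closedP m.
pose S : set A^o := [set b : A | exists u, b - u * a \in m].
have hS : submod S.
  split=> [|r b c [u bu] [v cv]]; first by exists 0; rewrite mul0r subrr; apply: rpred0.
  exists (r * u + v); rewrite [r *: b]/(r * b) mulrDl opprD addrACA -mulrA -mulrBr.
  exact: hm.2.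
have mS b : b \in m -> b \in closed_of_submod hS.
  by move=> bm; apply/asboolP; exists 0; rewrite mul0r subr0.
apply: contrapT => nu; have n1 : 1 \notin closed_of_submod hS.
  by apply/negP => /asboolP.
move/negP: am; apply; apply: (mmax _ mS n1); apply/asboolP.
by exists 1; rewrite mul1r subrr; apply: rpred0.
Qed.

Lemma graded_split (r : R) : exists2 a : base_ring G, r - val a \in I & True.
Proof.
have [/(_ r)[s [g [_ gG ->]]] _] := gr_sum G.
elim: s => [|i s [a IH _]]; first by exists 0 => //; rewrite big_nil subrr; apply: rpred0.
rewrite big_cons; case: i (gG i) => [|k] gi.
  exists (BaseRing gi + a) => //.
  by rewrite /= opprD addrACA subrr add0r.
exists a => //; rewrite -addrA; apply: rpredD => //; exact: irrelevant_comp gi.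
Qed.

(** Modulo I every r is congruent to an element of R_0, so an r outside (ms) is invertible modulo
    (ms), and no ideal lies strictly between (ms) and R. *)
Lemma dcc_maximal_sum (ms : seq R) :
  maximal_ideal m0 ->
  (forall a, a \in I -> gen_ideal ms a) -> (forall a, a \in J -> gen_ideal ms a) ->
  chain_cond false (gen_ideal ms) setT.
Proof.
move=> max Ims Jms; have hm := submod_gen_ideal ms.
have inv (r : R) : ~ gen_ideal ms r -> exists u : R, gen_ideal ms (1 - u * r).
  move=> nr; have [a ra _] := graded_split r.
  have Ja (b : base_ring G) : b \in m0 -> gen_ideal ms (val b).
    move=> bm; apply/Jms/mem_span_mod; exists b, 1; split=> //.
    by rewrite [_ *: _]mulr1.
  have am : a \notin m0.
    apply/negP => /Ja am; apply: nr; rewrite -[r](subrK (val a)).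
    by apply: (submodD hm) => //; apply: Ims.
  have [u /Ja ua] := maximal_ideal_inv max am.
  exists (val u); have := submod_sub hm ua (submodZ hm (val u) (Ims _ ra)).
  congr gen_ideal; rewrite [_ *: _]mulrBr /=.
  by rewrite opprB addrA subrK.
move=> S hS cS.
have [all1|/existsNP[N nN]] := pselect (forall n, S n 1).
  have full n : S n = setT.
    have [hn _ _] := hS n; apply/seteqP; split=> // r _.
    by have := submodZ hn r (all1 n); rewrite [_ *: _]mulr1.
  by exists 0%N => n _; rewrite !full.
have small n : (N <= n)%N -> S n = gen_ideal ms.
  move=> /(chain_anti cS) nS; have [hn An _] := hS n.
  apply/seteqP; split=> // r Sr; apply: contrapT => /inv[u ur].
  apply/nN/nS; rewrite -[1](subrK (u * r)); apply: (submodD hn); first exact: An.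
  exact: (submodZ hn u Sr).
by exists N => n Nn; rewrite !small.
Qed.

(** H / m0 H is a quotient of Z / ((xs)Z + B), as xs lies in m0 R. In the application W is the type
    of cocycles, j embeds it in the total module and p projects it to cohomology. *)
Lemma artinian_base_quotient (W D H : lmodType R) (j : W -> D) (p : W -> H)
    (Z B : set D) (xs : seq R) :
  linear j -> linear p -> injective j -> (forall h, exists w, p w = h) ->
  submod Z -> submod B -> B `<=` Z -> (forall f, Z f <-> exists w, j w = f) ->
  (forall w, B (j w) -> p w = 0) -> (forall x, x \in xs -> x \in J) ->
  chain_cond false (addmul xs Z B) Z ->
  artinian_module (quotient_module (base_smul m0 H)).
Proof.
move=> jlin plin jinj psurj hZ hB BZ Zj Bp xsJ dcc; apply/artinian_moduleP.
pose Q := base_smul m0 H; have hQ := submod_closedP Q.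
have hA : submod (addmul xs Z B) by apply: submod_addmul.
have dccW : chain_cond false [set w | addmul xs Z B (j w)] setT.
  apply: (chain_cond_inj jlin hA hZ _ dcc) => //.
    by apply: addmul_sub => // z x _; apply: submodZ.
  by move=> w _; apply/Zj; exists w.
have pilin : linear (fun w => qm_pi Q (p w)).
  by move=> a u v; rewrite plin linearP.
apply: (chain_cond_surj pilin _ dccW) => //; last first.
  move=> q _; elim/qm_piW: q => h; have [w <-] := psurj h; exists w => //.
  by rewrite subrr.
have hsm x (h : H) : x \in J -> x *: h \in Q.
  have hP := submod_preimage (scaler_linear h) hQ.
  apply: (span_modP hP) => _ [a [b [am ->]]]; rewrite /preimage /= -scalerA.
  by apply: mem_span_mod; exists a, (b *: h).
pose P : set D := [set f | exists2 w, j w = f & p w \in Q].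
have hP : submod P.
  split=> [|a _ _ [u <- hu] [v <- hv]].
    by exists 0; rewrite ?(lin0 jlin) ?(lin0 plin) ?rpred0.
  exists (a *: u + v); first by rewrite jlin.
  by rewrite plin rpredD // rpredZ.
have AP : addmul xs Z B `<=` P.
  apply: addmul_sub => // [f Bf|x f /xsJ xJ].
    have [w wf] := (Zj f).1 (BZ f Bf); exists w => //.
    by rewrite Bp ?wf // rpred0.
  move=> /Zj[w <-]; exists (x *: w); first by rewrite (linZ jlin).
  by rewrite (linZ plin); apply: hsm.
move=> w /AP[v /jinj <- hv]; apply/eqP.
by rewrite qm_pi_eq0.
Qed.
End Graded.

(** * Comparison of local cohomology with the intervals in the total module *)

Section Comparison.
Context (R : comNzRingType) (M : lmodType R) (E : injective_resolution M).
Context (I J : ideal R) (ys : seq R).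
Hypotheses (ysI : forall y, y \in ys -> y \in I)
  (Iys : forall a, a \in I -> gen_ideal ys a).

Let Js : set R^o := [set j | j \in J].
Let F := gamma Js ys (@total_deg R E).
Let hF : complex (@total_diff R M E) F :=
  gamma_complex (submod_closedP J) ys (resolution_complex E).
Local Notation Z := (cocycles (@total_diff R M E) F).
Local Notation B := (coboundaries (@total_diff R M E) F).
Local Notation gd k := (Gamma_map I J (ir_diff E k)).

Lemma gamma_totalP n (x : E n) :
  F n%:Z (inj_total x) <-> x \in @torsion_mod R I J (E n).
Proof.
have lin := @inj_total_linear R E n.
split=> [[_ h]|/(torsion_modP _ _ ysI Iys) h].
  apply/(torsion_modP _ _ ysI Iys) => y /h; apply: pair_torsion_sub => r /(congr1 (fun g : total_module E => g n)).
  by rewrite -(linZ lin) inj_total_in.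
split=> [|y /h]; first exact: inj_total_deg.
by apply: pair_torsion_sub => r rx; rewrite -(linZ lin) rx (lin0 lin).
Qed.

Section Degree.
Variable n : nat.
Let W := submodule (ker_mod (gd n)).

Definition cocycle_total (w : W) : total_module E :=
  inj_total (val (val w : Gamma I J (E n))).

Lemma cocycle_total_linear : linear cocycle_total.
Proof. by move=> a u v; rewrite /cocycle_total !linearP /=; apply: inj_total_linear. Qed.

Lemma cocycle_total_inj : injective cocycle_total.
Proof.
move=> u v e; do 2 apply: val_inj.
by have := congr1 (fun g : total_module E => g n) e; rewrite /cocycle_total !inj_total_in.
Qed.

Lemma cocycle_totalP f : Z n%:Z f <-> exists w, cocycle_total w = f.
Proof.
split=> [[Ff df]|[w <-]].
  have fE := total_degP Ff.1; rewrite fE in Ff df *.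
  move/gamma_totalP: Ff => fn.
  have dw : Submodule fn \in ker_mod (gd n).
    apply/eqP/val_inj => /=; rewrite total_diff_inj in df.
    by have := congr1 (fun g : total_module E => g n.+1) df; rewrite inj_total_in.
  by exists (Submodule dw).
split; first by apply/gamma_totalP; exact: (valP (val w)).
rewrite total_diff_inj; have /eqP/(congr1 val) /= := valP w.
by move=> ->; apply: (lin0 (@inj_total_linear R E n.+1)).
Qed.
End Degree.

(** Degree 0 is treated apart: [boundaries] is zero there, and so is the total complex in degree
    -1. *)
Lemma cocycle_total_boundary n (w : submodule (ker_mod (gd n))) :
  val w \in boundaries (fun k => gd k) n <-> B n%:Z (cocycle_total w).
Proof.
have predn (k : nat) : k.+1%:Z - 1 = k%:Z by rewrite -addn1 PoszD addrK.
case: n w => [|n] w; split.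
- move=> /eqP w0; exists 0; first by case: (cx_sub hF (0 - 1)).
  by rewrite (lin0 (cx_lin hF)) /cocycle_total w0 (lin0 (@inj_total_linear R E 0)).
- move=> [f [/total_deg_neg -> _]]; rewrite (lin0 (cx_lin hF)) => e.
  apply/eqP/val_inj; have := congr1 (fun g : total_module E => g 0%N) e.
  by rewrite /cocycle_total inj_total_in => <-.
- move=> /asboolP[u uw]; exists (inj_total (val u)).
    by rewrite predn; apply/gamma_totalP => //; apply: valP.
  by rewrite total_diff_inj /cocycle_total -uw.
move=> [f]; rewrite predn => Ff df.
have fE := total_degP Ff.1; rewrite fE in Ff df.
move/gamma_totalP: Ff => fn.
apply/asboolP; exists (Submodule fn); apply: val_inj => /=.
rewrite total_diff_inj in df; have := congr1 (fun g : total_module E => g n.+1) df.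
by rewrite /cocycle_total !inj_total_in.
Qed.

Lemma dcc_of_artinian_cohomology n :
  artinian_module (cohomology (fun k => gd k) n) -> chain_cond false (B n%:Z) (Z n%:Z).
Proof.
move=> /artinian_quotient_dcc dccW.
apply: (chain_cond_surj (@cocycle_total_linear n) _ dccW) => //.
  by move=> w /cocycle_total_boundary.
move=> f /cocycle_totalP[w <-]; exists w => //.
by rewrite subrr; case: (submod_coboundaries hF n).
Qed.
Lemma artinian_quotient_of_dcc (G : ring_grading R) (m0 : ideal (base_ring G)) xs n :
  (forall x, x \in xs -> x \in base_smul m0 R^o) ->
  chain_cond false (addmul xs (Z n%:Z) (B n%:Z)) (Z n%:Z) ->
  artinian_module (quotient_module (base_smul m0 (cohomology (fun k => gd k) n))).
Proof.
move=> xsJ; apply: (artinian_base_quotient (p := qm_pi _) (@cocycle_total_linear n)) => //.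
- exact: linearP.
- exact: cocycle_total_inj.
- by elim/qm_piW => w; exists w.
- exact: submod_cocycles.
- exact: submod_coboundaries.
- exact: coboundaries_sub.
- exact: cocycle_totalP.
by move=> w /cocycle_total_boundary wS; apply/eqP; rewrite qm_pi_eq0.
Qed.
End Comparison.

Lemma artinian_subsingleton (R : comNzRingType) (M : lmodType R) :
  (forall x : M, x = 0) -> artinian_module M.
Proof.
move=> M0 S _; exists 0%N => n _ x.
by rewrite (M0 x) !rpred0.
Qed.

Theorem theorem4p2 (R : comNzRingType) (G : ring_grading R)
    (m0 : ideal (base_ring G)) (M : lmodType R) (GM : module_grading G M)
    (E : injective_resolution M) (c : int) :
  noetherian_ring R ->
  standard_graded G ->
  local_ring m0 ->
  finitely_generated M ->
  (forall i : int, c < i ->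
     artinian_module
       (local_cohomology (irrelevant G) (base_smul m0 R^o) E i)) ->
  artinian_module
    (quotient_module
       (base_smul m0
          (local_cohomology (irrelevant G) (base_smul m0 R^o) E c))).
Proof.
move=> noeth _ [max _] fg art.
case: c art => [n|n] art; last first.
  apply: artinian_subsingleton => q; elim/qm_piW: q => x.
  suff -> : x = 0 by apply: linear0.
  by apply/matrixP => i [].
set I := irrelevant G; set J := base_smul m0 R^o.
have [ys ysI Iys] := ideal_fg (I : ideal R) noeth.
have [xs xsJ Jxs] := ideal_fg (J : ideal R) noeth.
apply: (artinian_quotient_of_dcc ysI Iys xsJ).
have gen_sub (s t : seq R) : {subset s <= t} -> gen_ideal s `<=` gen_ideal t.
  move=> st; apply: extend_sub; first exact: submod_gen_ideal.
    exact: extend_base.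
  by move=> a /st; apply: mem_extend; apply: submod_zero.
(* The descent starts with no cone taken and with all of xs still to be used. *)
apply: (@dcc_gamma_quotient R [set j | j \in J] (submod_closedP J) xs ys Jxs _ xs [::]
  (total_module E) (@total_diff R M E) (@total_deg R E) n%:Z).
- apply: (dcc_maximal_sum max) => a.
    by move=> /Iys; apply: gen_sub => y yy; rewrite mem_cat yy orbT.
  by move=> /Jxs; apply: gen_sub => y yy; rewrite mem_cat yy.
- exact: resolution_complex.
- exact: resolution_almost_divisible.
- by move=> k; apply: resolution_acc.
- by [].
- by [].
case=> [k|k] nk //; apply: (dcc_of_artinian_cohomology ysI Iys).
exact: (art k nk : artinian_module (cohomology _ _)).
Qed.
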